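(* Let $y_0\in Y$. If $$V_{per}(y_0)=\liminf_{T\to\infty}v_T(y_0),$$ then the limit $v(y_0):=\lim_{T\to\infty}v_T(y_0)$ exists and $v(y_0)=k^*(y_0)$.
   Context: Model. $Y\subset\mathbb R^n$ is a nonempty compact set, $\hat U$ is a compact metric space, $S$ is a Polish space. The function $f:Y\times\hat U\times S\to\mathbb R^n$ is bounded, continuous in $(y,u)$ on $Y\times\hat U$ and Borel measurable in $s$ on $S$. The $S$-valued random elements $s(0),s(1),\dots$ are independent and identically distributed on a common probability space; $s$ denotes a generic random element with the same distribution, and $E[\varphi(f(y,u,s))]$ is the expectation over $s$ with $(y,u)$ fixed. $U(\cdot)$ is an upper semicontinuous multivalued map from $Y$ to nonempty compact subsets of $\hat U$, and $f(y,u,s)\in Y$ for all $y\in Y$, $u\in U(y)$, $s\in S$. $G:=\{(y,u): y\in Y,\ u\in U(y)\}$ (a compact set). $\Pi$ is the set of control plans $\pi=\{\pi_t(\cdot)\}_{t=0,1,\dots}$, where each $\pi_t:Y\to\hat U$ is Borel measurable with $\pi_t(y)\in U(y)$ for all $y\in Y$. For $\pi\in\Pi$ and $y_0\in Y$, the state-control trajectory $(y^{\pi,y_0}(\cdot),u^{\pi,y_0}(\cdot))$ is defined by $y(0)=y_0$, $u(t)=\pi_t(y(t))$, $y(t+1)=f(y(t),u(t),s(t))$. The function $k:Y\times\hat U\to\mathbb R$ is continuous (hence bounded). For $T=1,2,\dots$, $v_T(y_0):=\frac1T\min_{\pi\in\Pi}E[\sum_{t=0}^{T-1}k(y^{\pi,y_0}(t),u^{\pi,y_0}(t))]$.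 Periodic regimes. For given $y_0\in Y$, a control plan $\pi\in\Pi$ is periodic regime generating (PRG) if there exist integers $T_0\ge0$ and $\mathcal T>0$ such that, for any continuous $q(y,u)$, $E[q(y^{\pi,y_0}(t),u^{\pi,y_0}(t))]=E[q(y^{\pi,y_0}(t+\mathcal T),u^{\pi,y_0}(t+\mathcal T))]$ for all $t\ge T_0$. $\Pi_{per}(y_0)\subset\Pi$ is the set of all PRG control plans (for $y_0$), and $$V_{per}(y_0):=\inf_{\pi\in\Pi_{per}(y_0)}\Big\{\lim_{T\to\infty}\frac1TE\Big[\sum_{t=0}^{T-1}k(y^{\pi,y_0}(t),u^{\pi,y_0}(t))\Big]\Big\}.$$ Augmented problem. $\mathcal P(G)$ and $\mathcal M_+(G)$ are the sets of probability and finite nonnegative measures on Borel subsets of $G$; $C(Y)$ is the space of continuous functions on $Y$. $W:=\{\gamma\in\mathcal P(G): \int_G(E[\varphi(f(y,u,s))]-\varphi(y))\gamma(dy,du)=0\ \forall\varphi\in C(Y)\}$. $\Omega(y_0)$ is the set of $(\gamma,\xi)\in\mathcal P(G)\times\mathcal M_+(G)$ such that $\gamma\in W$ and $\int_G(\varphi(y_0)-\varphi(y))\gamma(dy,du)+\int_G(E[\varphi(f(y,u,s))]-\varphi(y))\xi(dy,du)=0$ for all $\varphi\in C(Y)$; $k^*(y_0):=\inf_{(\gamma,\xi)\in\Omega(y_0)}\int_Gk(y,u)\gamma(dy,du)$. Infimum over the empty set is $+\infty$. *)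

(* Defs.v *)
From HB Require Import structures.
From mathcomp Require Import all_boot all_order all_algebra.
From mathcomp Require Import all_classical all_reals all_analysis.

Set Implicit Arguments.
Unset Strict Implicit.
Unset Printing Implicit Defensive.

Import Order.TTheory GRing.Theory Num.Theory.
Import numFieldNormedType.Exports.

Local Open Scope classical_set_scope.
Local Open Scope ring_scope.

(* The library's metricType is not pointed, whereas measurableType requires a
   point, so Borel sigma-algebras are formed on pointed metric spaces. *)
#[short(type="pmetricType")]
HB.structure Definition PMetric (K : numDomainType) :=
  {M of Metric K M & Pointed M}.

#[short(type="completeMetricType")]
HB.structure Definition CompleteMetric (K : numDomainType) :=
  {M of PMetric K M & Complete M}.

(* A Polish space is a completeMetricType satisfying this predicate. *)
Definition separable (T : topologicalType) : Prop :=
  exists2 D : set T, countable D & dense D.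

Notation borel T := (g_sigma_algebraType (@open T)).

(* Upper semicontinuity, relative to the subspace Y. *)
Definition upper_semicontinuous_on (X Z : topologicalType) (Y : set X)
    (U : X -> set Z) : Prop :=
  forall y, Y y -> forall V : set Z, open V -> U y `<=` V ->
    \forall y' \near within Y (nbhs y), U y' `<=` V.

Section iid.
Context d d' (T : measurableType d) (E : measurableType d') (R : realType)
  (P : probability T R) (X : nat -> {RV P >-> E}).

Definition mutually_independent : Prop :=
  forall (J : seq nat) (B : nat -> set E), uniq J ->
    (forall j, measurable (B j)) ->
    P (\bigcap_(j in [set` J]) (X j @^-1` B j)) =
    (\prod_(j <- J) P (X j @^-1` B j))%E.

Definition identically_distributed : Prop :=
  forall (i j : nat) (B : set E), measurable B ->
    P (X i @^-1` B) = P (X j @^-1` B).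

Definition iid : Prop := mutually_independent /\ identically_distributed.

End iid.

(* Functions on Y (resp. Y * Uhat) are represented by functions on the ambient
   space; only their restriction to Y (resp. Y `*` setT) plays a role. *)
Section control_system.
Context d (Om : measurableType d) (R : realType) (P : probability Om R).
Context (n : nat) (Uhat : pmetricType R) (S : completeMetricType R).

Local Notation X := 'rV[R]_n.

Variables (Y : set X) (U : X -> set Uhat) (f : X -> Uhat -> S -> X).
Variables (s : nat -> {RV P >-> borel S}) (k : X * Uhat -> R).

Definition graph : set (X * Uhat) := [set z | Y z.1 /\ U z.1 z.2].

Definition plan : set (nat -> X -> Uhat) :=
  [set pi | forall t,
    measurable_fun (Y : set (borel X)) (pi t : borel X -> borel Uhat) /\
    forall y, Y y -> U y (pi t y)].

Section trajectory.
Variables (pi : nat -> X -> Uhat) (y0 : X).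

Fixpoint state (t : nat) (w : Om) : X :=
  if t is t'.+1 then f (state t' w) (pi t' (state t' w)) (s t' w) else y0.

Definition control (t : nat) (w : Om) : Uhat := pi t (state t w).

Definition total_cost (T : nat) : \bar R :=
  ('E_P[fun w => (\sum_(t < T) k (state t w, control t w))%R])%E.

Definition average_cost (T : nat) : \bar R :=
  ((T%:R^-1)%:E * total_cost T)%E.

Definition PRG : Prop :=
  exists T0 period : nat, (0 < period)%N /\
    forall q : X * Uhat -> R, {within Y `*` [set: Uhat], continuous q} ->
    forall t, (T0 <= t)%N ->
      ('E_P[fun w => q (state t w, control t w)] =
       'E_P[fun w => q (state (t + period) w, control (t + period) w)])%E.

End trajectory.

Definition value (y0 : X) (T : nat) : \bar R :=
  ((T%:R^-1)%:E * ereal_inf [set total_cost pi y0 T | pi in plan])%E.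

Definition plan_per (y0 : X) : set (nat -> X -> Uhat) :=
  [set pi | plan pi /\ PRG pi y0].

Definition value_per (y0 : X) : \bar R :=
  ereal_inf [set limn (average_cost pi y0) | pi in plan_per y0].

(* s 0 serves as the generic random element. *)
Definition drift (phi : X -> R) (z : X * Uhat) : \bar R :=
  ('E_P[fun w => phi (f z.1 z.2 (s 0%N w))] - (phi z.1)%:E)%E.

(* Measures on Borel subsets of the graph are represented by Borel measures on
   X * Uhat that vanish off the graph. *)
Definition W : set (probability (borel (X * Uhat)%type) R) :=
  [set gamma : probability (borel (X * Uhat)%type) R | gamma (~` graph) = 0%E /\
    forall phi : X -> R, {within Y, continuous phi} ->
      (\int[gamma]_(z in graph) drift phi z = 0)%E].

Definition Omega (y0 : X) : set (probability (borel (X * Uhat)%type) R *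
    {finite_measure set (borel (X * Uhat)%type) -> \bar R}) :=
  [set p : probability (borel (X * Uhat)%type) R *
      {finite_measure set (borel (X * Uhat)%type) -> \bar R} | [/\ W p.1, p.2 (~` graph) = 0%E &
    forall phi : X -> R, {within Y, continuous phi} ->
      (\int[p.1]_(z in graph) (phi y0 - phi z.1)%:E +
       \int[p.2]_(z in graph) drift phi z = 0)%E]].

Definition kstar (y0 : X) : \bar R :=
  ereal_inf [set (\int[p.1]_(z in graph) (k z)%:E)%E | p in Omega y0].

End control_system.

(* Main.v *)
Require Import Defs.
From HB Require Import structures.
From mathcomp Require Import all_boot all_order all_algebra.
From mathcomp Require Import all_classical all_reals all_analysis.
From mathcomp Require Import measurable_realfun.
From mathcomp Require Import lra.

Set Implicit Arguments.
Unset Strict Implicit.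
Unset Printing Implicit Defensive.

Import Order.TTheory GRing.Theory Num.Theory.
Import numFieldNormedType.Exports.

Local Open Scope classical_set_scope.
Local Open Scope ring_scope.

(* The chain k* <= V_per = liminf v_T <= limsup v_T <= k* makes all terms equal.

   k* <= V_per: along a periodic regime let gamma be the average over one period
   of the laws of the state-control pair, and let xi be the average over the same
   period of the sums of the earlier laws; telescoping shows that (gamma, xi) is
   in Omega(y0), and the integral of k against gamma is the long-run average cost.

   limsup v_T <= k*: let V_0 = 0 and
   V_{m+1}(y) = min_{u in U(y)} (k(y,u) + E V_m(f(y,u,s))). Each V_m is bounded and
   lower semicontinuous, minimizers can be selected measurably, and T v_T(y0) is at
   most V_T(y0). As V_m is the limit of an increasing sequence of continuous
   functions, the identities defining W and Omega(y0) hold for V_m. For (gamma, xi)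
   in Omega(y0), the identity for W gives int V_T dgamma <= T int k dgamma; since
   E V_T(f(y,u,s)) - V_T(y) >= -2 sup |k| on G, the other identity gives
   V_T(y0) <= int V_T dgamma + 2 sup |k| xi(G). Divide by T. *)

(** * Lower semicontinuity, compactness and bounded integrands *)

(** With U only upper semicontinuous, minimizing over U(y) can destroy continuity in y even for
    continuous data. Lower semicontinuity is what survives a Bellman step, because the sublevel sets
    of a minimum are projections of compact sets; hence the test identities, given for continuous
    functions only, have to be extended.

    Bounding T v_T(y0) by V_T(y0) takes one plan: the minimizers applied in decreasing order of
    their index.

    Measurability is the other obstacle: gamma and xi are Borel measures on a product space, while f
    is continuous in (y,u) and merely measurable in s. Compactness of Y and of the control space
    supplies countable dense families that reduce these questions to countable unions.

    That Omega(y0) is nonempty comes from the hypothesis, which through V_per bounds k* by the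
    finite number liminf v_T(y0). *)

Definition lsc_on (T : topologicalType) (R : realType) (D : set T)
    (g : T -> R) : Prop :=
  forall c, closed (D `&` [set x | g x <= c]).

Lemma continuous_lsc_on (T : topologicalType) (R : realType) (D : set T)
    (g : T -> R) :
  closed D -> {within D, continuous g} -> lsc_on D g.
Proof.
move=> cD cg c; rewrite closed_setSI//.
by move/continuous_closedP : cg => /(_ _ (@closed_le R c)).
Qed.

Lemma closed_borel (T : ptopologicalType) (A : set T) :
  closed A -> measurable (A : set (borel T)).
Proof.
move=> cA; rewrite -(setCK A); apply: measurableC.
by apply: sub_sigma_algebra; exact: closed_openC.
Qed.

Lemma lsc_on_measurable (T : ptopologicalType) (R : realType) (D : set T)
    (g : T -> R) : lsc_on D g -> measurable_fun (D : set (borel T)) (g : borel T -> R).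
Proof.
move=> lg mD; apply: (measurability _ (RGenOInfty.measurableE R)) => //.
move=> _ [_ [x ->] <-].
have -> : D `&` g @^-1` `]x, +oo[%classic = D `\` (D `&` [set y | g y <= x]).
  apply/seteqP; split => y /=; rewrite in_itv/= andbT.
    by move=> [Dy xg]; split=> // -[_]; rewrite leNgt xg.
  by move=> [Dy h]; split=> //; rewrite ltNge; apply/negP => ?; apply: h.
by apply: measurableD => //; exact: closed_borel.
Qed.

Lemma closure_seq (R : realType) (T : pseudoMetricType R) (A : set T) z :
  closure A z -> exists2 u : nat -> T, forall i, A (u i) & u @ \oo --> z.
Proof.
move=> clAz.
have H i : exists x, A x /\ ball z i.+1%:R^-1 x.
  have [|x [Ax bx]] := clAz (ball z i.+1%:R^-1).
    by apply: nbhsx_ballx; rewrite invr_gt0.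
  by exists x.
have [u uP] := choice H; exists u; first by move=> i; have [] := uP i.
apply/cvg_ballP => e e0.
near=> i; apply: (@le_ball _ _ _ i.+1%:R^-1); last by have [] := uP i.
by apply: ltW; near: i; exact: near_infty_natSinv_lt (PosNum e0).
Unshelve. all: by end_near. Qed.

(** Total boundedness: the centres of finite covers by balls of radius [1 / (m + 1)], taken over all
    [m], form a countable dense family. The countable covers in the selection and joint
    measurability arguments come from here. *)
Lemma compact_dense_seq (R : realType) (T : pseudoPMetricType R) (K : set T) :
  compact K -> K !=set0 ->
  exists2 a : nat -> T, forall j, K (a j) &
    forall z e, K z -> 0 < e -> exists j, ball (a j) e z.
Proof.
move=> cK [z0 Kz0].
have npos m : (0 : R) < m.+1%:R^-1 by rewrite invr_gt0.
have h m : finite_subset_cover K (fun z => (ball z (PosNum (npos m))%:num)°) K.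
  move: cK; rewrite compact_cover; apply.
  - by move=> z _; exact: open_interior.
  - by move=> z Kz; exists z => //; exact: nbhsx_ballx.
have h' m : exists D' : seq T, {subset D' <= K} /\
    K `<=` cover [set` D'] (fun z => (ball z (PosNum (npos m))%:num)°).
  by have [D' ? ?] := h m; exists (finmap.enum_fset D').
have [F FP] := choice h'.
(* The index encodes a pair (cover, position in the cover); [z0] fills codes of no pair and
   positions past the end. *)
pose a p : T := if @unpickle (nat * nat)%type p is Some (m, i) then nth z0 (F m) i else z0.
exists a.
  move=> j; rewrite /a; case: unpickle => [[m i]|//].
  have [iF|/(nth_default _) ->//] := ltnP i (size (F m)).
  by have [/(_ (nth z0 (F m) i))] := FP m; rewrite mem_nth// inE => /(_ isT).
move=> z e Kz e0.
have [m _ /(_ m (leqnn _)) me] := near_infty_natSinv_lt (PosNum e0).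
have [_ /(_ z Kz)[x /= xF bxz]] := FP m.
exists (pickle (m, index x (F m))); rewrite /a pickleK nth_index//.
by apply: (@le_ball _ _ _ m.+1%:R^-1); [exact: ltW|exact: interior_subset bxz].
Qed.

Lemma nested_compact (T : ptopologicalType) (K : set T) (F : nat -> set T) :
  compact K -> (forall m, closed (F m)) -> (forall m, F m `<=` K) ->
  (forall m, F m.+1 `<=` F m) -> (forall m, F m !=set0) ->
  \bigcap_m F m !=set0.
Proof.
move=> cK cF FK decF F0.
have dec m p : (m <= p)%N -> F p `<=` F m.
  move=> /subnK <-; elim: (p - m)%N => [|q IH] x; first by rewrite add0n.
  by rewrite addSn => /decF/IH.
move: cK; rewrite compact_In0 => /(_ _ setT F); apply.
  by exists F => // i _; rewrite setIidr.
move=> D' _; have [x Fx] := F0 (\max_(i <- finmap.enum_fset D') i)%N.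
by exists x => i iD' /=; apply: dec Fx; exact: leq_bigmax_seq.
Qed.

Section bounded_integration.
Context d (T : measurableType d) (R : realType)
  (mu : {finite_measure set T -> \bar R}).
Implicit Types (D : set T) (g : T -> R) (M : R).

Lemma bounded_integrable D g M : measurable D -> measurable_fun D g ->
  (forall x, D x -> `|g x| <= M) -> mu.-integrable D (EFin \o g).
Proof.
move=> mD mg gM; apply: measurable_bounded_integrable => //.
  by rewrite -ge0_fin_numE ?measure_ge0 ?fin_num_measure.
exists M; split; first exact: num_real.
by move=> N MN x Dx /=; apply: le_trans (gM x Dx) (ltW MN).
Qed.

Lemma EFin_Rintegral D g M : measurable D -> measurable_fun D g ->
  (forall x, D x -> `|g x| <= M) ->
  (\int[mu]_(x in D) (g x)%:E)%E = (\int[mu]_(x in D) g x)%:E.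
Proof.
move=> mD mg gM; rewrite /Rintegral fineK//.
exact: integrable_fin_num (bounded_integrable mD mg gM).
Qed.

Lemma bounded_cvg_Rintegral D (h : nat -> T -> R) g M : measurable D ->
  (forall j, measurable_fun D (h j)) ->
  (forall j x, D x -> `|h j x| <= M) ->
  (forall x, D x -> h j x @[j --> \oo] --> g x) ->
  \int[mu]_(x in D) h j x @[j --> \oo] --> \int[mu]_(x in D) g x.
Proof.
move=> mD mh hM hg.
have mg : measurable_fun D g by exact: measurable_fun_cvg hg.
have gM x : D x -> `|g x| <= M.
  move=> Dx; apply: (closed_cvg _ (closed_le (y := M)) _ _ (cvg_norm (hg x Dx))).
  by apply: nearW => j; exact: hM.
have := EFin_Rintegral mD mg gM.
have := @dominated_cvg _ _ R mu D mD (fun j x => (h j x)%:E) (EFin \o g) (cst M%:E).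
move=> /(_ _ _ _ _ _)/= + E; rewrite E => H.
apply: (@fine_cvg _ _ _ _ (fun j => \int[mu]_(x in D) (h j x)%:E)%E); apply: H => //.
- by move=> j; apply/measurable_EFinP; exact: mh.
- by move=> x Dx; apply: cvg_EFin; [exact: nearW|exact: hg].
- apply: (@bounded_integrable _ (cst M) `|M|) => //.
Qed.

Lemma Rintegral_bound D g M : measurable D -> measurable_fun D g -> 0 <= M ->
  (forall x, D x -> `|g x| <= M) -> `|\int[mu]_(x in D) g x| <= M * fine (mu D).
Proof.
move=> mD mg M0 gM; have ig := bounded_integrable mD mg gM.
apply: le_trans (le_normr_Rintegral mD ig) _.
rewrite -(Rintegral_cst mu mD); apply: le_Rintegral => //.
  apply: (@bounded_integrable D (fun x => `|g x|) M) => //; first exact: measurableT_comp.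
  by move=> x Dx; rewrite normr_id; exact: gM.
by apply: (@bounded_integrable D (cst M) M) => // x _ /=; rewrite ger0_norm.
Qed.

End bounded_integration.

(** * Inf-convolutions and approximation from below *)

Section inf_convolution.
Context (R : realType) (V : normedModType R) (A : set V) (g : V -> R) (M : R).
Hypotheses (A0 : A !=set0) (gM : forall y, A y -> M <= g y).

(** The Pasch-Hausdorff envelope: the largest [j]-Lipschitz function on all of [V] that lies below
    [g] on [A]. For [g = 0] and [j = 1] it is the distance to [A]. *)
Definition inf_conv (j : nat) (x : V) : R :=
  inf [set g y + j%:R * `|x - y| | y in A].

Lemma inf_conv_le j x y : A y -> inf_conv j x <= g y + j%:R * `|x - y|.
Proof.
move=> Ay; apply: ge_inf; last by exists y.
exists M => _ [z Az <-]; rewrite (le_trans (gM Az))// lerDl mulr_ge0//.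
Qed.

Lemma le_inf_conv j x c :
  (forall y, A y -> c <= g y + j%:R * `|x - y|) -> c <= inf_conv j x.
Proof.
move=> h; apply: lb_le_inf.
  by have [y Ay] := A0; exists (g y + j%:R * `|x - y|), y.
by move=> _ [y Ay <-]; exact: h.
Qed.

Lemma inf_conv_lip j x x' : `|inf_conv j x - inf_conv j x'| <= j%:R * `|x - x'|.
Proof.
have H a b : inf_conv j a - inf_conv j b <= j%:R * `|a - b|.
  rewrite lerBlDl -lerBlDr; apply: le_inf_conv => y Ay.
  have h1 := inf_conv_le j a Ay.
  have h2 : `|a - y| <= `|a - b| + `|b - y|.
    by have := ler_normD (a - b) (b - y); rewrite addrA subrK.
  have h3 : j%:R * `|a - y| <= j%:R * (`|a - b| + `|b - y|) by rewrite ler_wpM2l.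
  lra.
by rewrite ler_norml H andbT lerNl opprB distrC H.
Qed.

Lemma continuous_inf_conv j : continuous (inf_conv j).
Proof.
move=> x; apply/cvgrPdist_le => e e0.
(* [j.+1] in place of the Lipschitz constant [j] avoids a division by zero at [j = 0]. *)
have : \forall t \near x, `|x - t| <= e / j.+1%:R.
  by apply: cvgr_dist_le => //; rewrite divr_gt0.
apply: filterS => t xt; apply: (le_trans (inf_conv_lip j x t)).
apply: (@le_trans _ _ (j.+1%:R * `|x - t|)).
  by rewrite ler_wpM2r// ler_nat.
by rewrite -ler_pdivlMl// mulrC.
Qed.

End inf_convolution.

(** Inf-convolutions do it: within some distance [d] of [x] lower semicontinuity keeps [g] above
    [g x - e], and beyond [d] the penalty [j * d] eventually exceeds [2 * M], the most by which [g]
    can vary. *)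
Lemma lsc_approx (R : realType) (V : normedModType R) (A : set V) (g : V -> R)
    (M : R) : A !=set0 -> (forall y, A y -> `|g y| <= M) -> lsc_on A g ->
  exists phi : nat -> V -> R,
    [/\ forall j, continuous (phi j),
        forall j x, A x -> `|phi j x| <= M,
        forall j x, A x -> phi j x <= g x &
        forall x, A x -> phi j x @[j --> \oo] --> g x].
Proof.
move=> A0 gM lg.
have gM' y : A y -> - M <= g y by move=> /gM; rewrite ler_norml => /andP[].
have le_g j x : A x -> inf_conv A g j x <= g x.
  by move=> Ax; have := inf_conv_le gM' j x Ax; rewrite subrr normr0 mulr0 addr0.
exists (inf_conv A g); split => //.
- by move=> j; exact: (continuous_inf_conv A0 gM').
- move=> j x Ax; rewrite ler_norml; apply/andP; split; last first.
    by rewrite (le_trans (le_g j x Ax))// (le_trans (ler_norm _)) ?gM.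
  by apply: le_inf_conv => // y Ay; rewrite (le_trans (gM' _ Ay))// lerDl mulr_ge0.
- move=> x Ax; apply/cvgrPdist_le => e e0.
  have /closed_openC oC := lg (g x - e).
  have /nbhs_ballP[d /= d0 dP] : nbhs x (~` (A `&` [set y | g y <= g x - e])).
    apply: open_nbhs_nbhs; split => // -[_ /=].
    by rewrite leNgt ltrBlDr ltrDl e0.
  near=> j; rewrite ger0_norm ?subr_ge0 ?le_g// lerBlDr -lerBlDl.
  apply: le_inf_conv => // y Ay.
  have [xy|xy] := ltP `|x - y| d.
    have : ~ (A y /\ g y <= g x - e) by apply: dP; rewrite -ball_normE.
    move=> /not_andP[//|/negP]; rewrite -ltNge => /ltW h.
    by rewrite (le_trans h)// lerDl mulr_ge0.
  have jd : 2 * M <= j%:R * d.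
    rewrite -ler_pdivrMr//; near: j; exact: nbhs_infty_ger.
  have := gM' _ Ay; have := gM _ Ax; rewrite ler_norml => /andP[_ ? ?].
  have : j%:R * d <= j%:R * `|x - y| by rewrite ler_wpM2l.
  lra.
Unshelve. all: by end_near. Qed.

Lemma prob_Rintegral_bound d (T : measurableType d) (R : realType)
    (P : probability T R) (g : T -> R) M : measurable_fun setT g ->
  (forall x, `|g x| <= M) -> `|\int[P]_x g x| <= M.
Proof.
move=> mg gM; have M0 : 0 <= M by rewrite (le_trans _ (gM point)).
have := @Rintegral_bound _ _ _ P setT g M measurableT mg M0 (fun x _ => gM x).
by rewrite [X in fine X](probability_setT P) mulr1.
Qed.

Lemma prob_bounded_integrable d (T : measurableType d) (R : realType)
    (P : probability T R) (g : T -> R) M : measurable_fun setT g ->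
  (forall x, `|g x| <= M) -> P.-integrable setT (EFin \o g).
Proof. by move=> mg gM; apply: (@bounded_integrable _ _ _ P setT g M). Qed.

Lemma prob_EFin_Rintegral d (T : measurableType d) (R : realType)
    (P : probability T R) (g : T -> R) M : measurable_fun setT g ->
  (forall x, `|g x| <= M) -> (\int[P]_x (g x)%:E)%E = (\int[P]_x g x)%:E.
Proof. by move=> mg gM; apply: (@EFin_Rintegral _ _ _ P setT g M). Qed.

Lemma prob_Rintegral_cst d (T : measurableType d) (R : realType)
    (P : probability T R) (r : R) : \int[P]_x r = r.
Proof. by rewrite Rintegral_cst// [X in fine X](probability_setT P) mulr1. Qed.

(** * Weighted sums of finite measures, used to build occupation measures *)

Section weighted_sum.
Context d (T : measurableType d) (R : realType).
Context (m_ : nat -> {finite_measure set T -> \bar R}) (N : nat) (c : {nonneg R}).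

Definition weighted_sum : set T -> \bar R := mscale c (msum m_ N).

HB.instance Definition _ := Measure.on weighted_sum.

Lemma weighted_sumE A : weighted_sum A = (c%:num%:E * \sum_(i < N) m_ i A)%E.
Proof. by []. Qed.

Let weighted_sum_fin : fin_num_fun weighted_sum.
Proof.
move=> A mA; rewrite weighted_sumE fin_numM// sum_fin_num.
by apply/allP => x /mapP[i _ ->]; exact: fin_num_measure.
Qed.

HB.instance Definition _ := Measure_isFinite.Build _ _ _ weighted_sum weighted_sum_fin.

Lemma Rintegral_weighted_sum D (g : T -> R) M : measurable D ->
  measurable_fun D g -> (forall x, D x -> `|g x| <= M) ->
  \int[weighted_sum]_(x in D) g x = c%:num * \sum_(i < N) \int[m_ i]_(x in D) g x.
Proof.
move=> mD mg gM.
(* Linearity in the measure is available for nonnegative integrands only, hence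
   the shift by M. *)
have gM0 x : D x -> 0 <= g x + M.
  by move=> /gM; rewrite ler_norml => /andP[+ _]; rewrite -lerBlDr sub0r.
have shift (mu : {finite_measure set T -> \bar R}) :
    \int[mu]_(x in D) (g x + M) = \int[mu]_(x in D) g x + M * fine (mu D).
  rewrite RintegralD//; last 2 first.
    exact: bounded_integrable gM.
    by apply: (@bounded_integrable _ _ _ mu D (cst M) `|M|).
  by rewrite Rintegral_cst.
have mgM : measurable_fun D (fun x => (g x + M)%:E).
  by apply/measurable_EFinP; exact: measurable_funD.
have gM2 x : D x -> `|g x + M| <= M + `|M|.
  by move=> Dx; apply: le_trans (ler_normD _ _) _; rewrite lerD2r gM.
have fin (mu : {finite_measure set T -> \bar R}) := @EFin_Rintegral _ _ _ mu D
  (fun x => g x + M) (M + `|M|) mD (measurable_funD mg (measurable_cst _)) gM2.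
have H : \int[weighted_sum]_(x in D) (g x + M) =
    c%:num * \sum_(i < N) \int[m_ i]_(x in D) (g x + M).
  apply: EFin_inj; rewrite -fin EFinM -sumEFin.
  rewrite /weighted_sum ge0_integral_mscale// ge0_integral_measure_sum//.
  by congr (_ * _)%E; apply: eq_bigr => i _; rewrite fin.
move: H; rewrite shift; under eq_bigr do rewrite shift.
rewrite big_split/= mulrDr.
have -> : fine (weighted_sum D) = c%:num * \sum_(i < N) fine (m_ i D).
  rewrite weighted_sumE fineM//; last first.
    by rewrite sum_fin_num; apply/allP => x /mapP[i _ ->]; exact: fin_num_measure.
  congr (_ * _); apply: EFin_inj; rewrite fineK; last first.
    by rewrite sum_fin_num; apply/allP => x /mapP[i _ ->]; exact: fin_num_measure.
  by rewrite -sumEFin; apply: eq_bigr => i _; rewrite fineK ?fin_num_measure.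
rewrite -mulr_sumr [M * (_ * _)]mulrCA; exact: addIr.
Qed.

End weighted_sum.

Lemma weighted_sum_probability d (T : measurableType d) (R : realType)
    (m_ : nat -> {finite_measure set T -> \bar R}) N (c : {nonneg R}) :
  weighted_sum m_ N c setT = 1%E ->
  exists Q : probability T R, forall A, Q A = weighted_sum m_ N c A.
Proof.
move=> H; pose Q : probability T R :=
  HB.pack (weighted_sum m_ N c) (Measure_isProbability.Build _ _ _ (weighted_sum m_ N c) H).
by exists Q.
Qed.

(** * Measurable selection of minimizers *)

Section selection.
Context (R : realType) (T : ptopologicalType) (Z : pmetricType R) (Y : set T).
Implicit Types (M : T -> set Z) (C : nat -> set Z) (F : set Z).

Definition hits M F : set T := Y `&` [set y | M y `&` F !=set0].

Definition weakly_measurable M : Prop :=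
  forall F, closed F -> measurable (hits M F : set (borel T)).

Definition refine M C (y : T) : set Z :=
  [set u | exists i, [/\ M y u, C i u &
    forall i', (i' < i)%N -> M y `&` C i' = set0]].

Lemma refine_sub M C y : refine M C y `<=` M y.
Proof. by move=> u [i []]. Qed.

Lemma refineE M C y : \bigcup_i C i = setT -> M y !=set0 ->
  exists i, refine M C y = M y `&` C i /\ M y `&` C i !=set0.
Proof.
move=> CT [u0 Mu0].
have ex : exists i, `[< M y `&` C i !=set0 >].
  have [i _ Ci] : (\bigcup_i C i) u0 by rewrite CT.
  by exists i; apply/asboolP; exists u0.
case: (ex_minnP ex) => i /asboolP Mi imin; exists i; split => //.
have low i' : (i' < i)%N -> M y `&` C i' = set0.
  move=> i'i; apply: contrapT => /eqP/set0P/asboolP/imin; by rewrite leqNgt i'i.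
apply/seteqP; split => u /=; last by move=> [? ?]; exists i.
move=> [k [Mu Cu klow]]; split => //.
have [ki|ik|E] := ltngtP k i; last by rewrite -E.
  by have := low _ ki; rewrite -subset0 => /(_ u); case.
by have [v Mv] := Mi; have := klow _ ik; rewrite -subset0 => /(_ v Mv).
Qed.

(** Selecting the first index turns the hit sets of the refinement into countable Boolean
    combinations of hit sets of [M]; this is what preserves weak measurability. *)
Lemma hits_refine M C F : hits (refine M C) F =
  \bigcup_i (hits M (C i `&` F) `\` \bigcup_(i' in [set i' | (i' < i)%N]) hits M (C i')).
Proof.
apply/seteqP; split => y /=.
  move=> [Yy [u /= [[i [Mu Cu low]] Fu]]]; exists i => //; split.
    by split => //; exists u.
  by move=> [i' /= i'i [_ /= [v Mv]]]; have := low _ i'i; rewrite -subset0 => /(_ v Mv).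
move=> [i _ [[Yy [u /= [Mu [Cu Fu]]]] low]]; split => //; exists u; split => //.
exists i; split => // i' i'i; apply: contrapT => /eqP/set0P h; apply: low.
by exists i'.
Qed.

Lemma weakly_measurable_refine M C : (forall i, closed (C i)) ->
  weakly_measurable M -> weakly_measurable (refine M C).
Proof.
move=> cC wM F cF; rewrite hits_refine; apply: bigcupT_measurable => i.
apply: measurableD; first by apply: wM; exact: closedI.
by apply: bigcup_measurable => i' _; exact: wM.
Qed.

(* Kuratowski and Ryll-Nardzewski: M y is cut down successively by the first set
   that it meets in countable closed covers of vanishing diameter, until only one
   point is left. *)
Lemma weakly_measurable_selection M : compact [set: Z] ->
  measurable (Y : set (borel T)) ->
  weakly_measurable M ->
  (forall y, Y y -> closed (M y)) -> (forall y, Y y -> M y !=set0) ->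
  exists sigma : T -> Z, measurable_fun (Y : set (borel T)) (sigma : borel T -> borel Z) /\
    forall y, Y y -> M y (sigma y).
Proof.
move=> cZ mY wM clM M0.
have [a _ aP] := compact_dense_seq cZ (ex_intro _ point I).
(* Closures of balls, because [weakly_measurable] only tests closed sets and because the refined
   values have to stay closed. *)
pose C m i := closure (ball (a i) (m.+1%:R^-1 : R)).
have cC m i : closed (C m i) by exact: closed_closure.
have CT m : \bigcup_i C m i = setT.
  apply/seteqP; split => // z _; have [|i bi] := aP z m.+1%:R^-1 I.
    by rewrite invr_gt0.
  by exists i => //; exact: subset_closure.
pose Ms := fix Ms m := if m is m'.+1 then refine (Ms m') (C m') else M.
have wMs m : weakly_measurable (Ms m).
  by elim: m => [//|m IH] /=; exact: weakly_measurable_refine.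
have Ms0 m y : Y y -> closed (Ms m y) /\ Ms m y !=set0.
  move=> Yy; elim: m => [|m [IHc IH0]] /=; first by split; [exact: clM|exact: M0].
  have [i [-> ?]] := refineE (CT m) IH0; split => //; exact: closedI.
(* Compactness exchanges the intersection with the hitting condition. [F = setT] will show that the
   intersection is nonempty, a general [F] will give the preimages of closed sets. *)
have cap F y : Y y -> closed F -> (forall m, Ms m y `&` F !=set0) ->
    (\bigcap_m Ms m y) `&` F !=set0.
  move=> Yy cF MF.
  have [||||u uP] := @nested_compact Z setT (fun m => Ms m y `&` F) cZ => //.
  - by move=> m; apply: closedI => //; have [] := Ms0 m y Yy.
  - by move=> m; apply: setSI => /=; exact: refine_sub.
  - exists u; split; first by move=> m _; have [] := uP m I.
    by have [] := uP 0%N I.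
have uniq y u v : Y y -> (\bigcap_m Ms m y) u -> (\bigcap_m Ms m y) v -> u = v.
  move=> Yy Mu Mv; apply: close_eq; first exact: metric_hausdorff.
  rewrite ball_close => e.
  (* One quarter pays for the radius of the cell and one for passing from the closure to the ball;
     two points of the same cell use this twice. *)
  have e4 : 0 < e%:num / 4 :> R by rewrite divr_gt0.
  have [m _ /(_ m (leqnn _)) me] := near_infty_natSinv_lt (PosNum e4).
  have [_ Mm0] := Ms0 m y Yy.
  have [i [Ei _]] := refineE (CT m) Mm0.
  have near_a w : (\bigcap_m Ms m y) w -> ball (a i) (e%:num / 4 + e%:num / 4) w.
    move=> /(_ m.+1 I) /=; rewrite Ei => -[_ /(_ (ball w (e%:num / 4)))].
    move=> /(_ (nbhsx_ballx _ _ _))[//|x [bx wx]].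
    by apply: (ball_triangle (le_ball (ltW me) bx)); exact: ball_sym.
  have -> : e%:num = (e%:num / 4 + e%:num / 4) + (e%:num / 4 + e%:num / 4) by lra.
  by apply: (@ball_triangle _ _ (a i)); [apply: ball_sym|]; exact: near_a.
have ne y : Y y -> \bigcap_m Ms m y !=set0.
  move=> Yy; have [|u [uM _]] := @cap setT y Yy closedT; last by exists u.
  by move=> m; rewrite setIT; have [] := Ms0 m y Yy.
pose sigma y : Z := get (\bigcap_m Ms m y).
have sP y : Y y -> (\bigcap_m Ms m y) (sigma y) by move=> /ne [u uM]; exact: (getI uM).
exists sigma; split; last by move=> y /sP /(_ 0%N I).
(* As the intersection is a single point, it lies in [F] exactly when every stage meets [F]. *)
have pre F : closed F -> Y `&` sigma @^-1` F = \bigcap_m hits (Ms m) F.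
  move=> cF; apply/seteqP; split => y.
    move=> [Yy /= Fs] m _; split => //; exists (sigma y); split => //.
    exact: (sP y Yy m I).
  move=> h; have [Yy _] := h 0%N I; split => //=.
  have [|u [Mu Fu]] := @cap F y Yy cF; first by move=> m; have [] := h m I.
  by rewrite (uniq y (sigma y) u)//; exact: sP.
apply: (@measurability _ _ (borel T) (borel Z) Y sigma (@open Z)) => // _ [B oB <-].
have -> : Y `&` sigma @^-1` B = Y `\` (Y `&` sigma @^-1` (~` B)).
  by rewrite setDE setCI setIUr setICr set0U preimage_setC setCK.
apply: measurableD => //; rewrite pre; last exact: open_closedC.
by apply: bigcapT_measurable => m; apply: wMs; exact: open_closedC.
Qed.

End selection.

Section argmin.
Context (R : realType) (T : ptopologicalType) (Z : pmetricType R) (Y : set T).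
Context (G : set (T * Z)) (g : T * Z -> R).
Hypotheses (hT : hausdorff_space T) (cZ : compact [set: Z]) (cG : compact G).
Hypotheses (GY : forall z, G z -> Y z.1) (G0 : forall y, Y y -> exists u, G (y, u)).
Hypothesis (lg : lsc_on G g) (M : R) (gM : forall z, G z -> `|g z| <= M).

(** The set is the first projection of a closed part of the compact [G]. For [F = setT] this yields
    lower semicontinuity of the minimum over the sections. *)
Lemma closed_proj_sublevel (F : set Z) c : closed F ->
  closed (Y `&` [set y | exists u, [/\ G (y, u), F u & g (y, u) <= c]]).
Proof.
move=> cF.
have -> : Y `&` [set y | exists u, [/\ G (y, u), F u & g (y, u) <= c]] =
    fst @` ((G `&` [set z | g z <= c]) `&` snd @^-1` F).
  apply/seteqP; split => y /=.
    by move=> [Yy [u [Gu Fu gu]]]; exists (y, u).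
  by move=> [[y' u] /= [[Gz gz] Fz] <-]; split; [exact: (GY Gz)|exists u].
apply: compact_closed => //; apply: continuous_compact.
  by apply: continuous_subspaceT => z; exact: cvg_fst.
apply: (subclosed_compact _ cG); last by move=> z [[]].
apply: closedI => //; apply: preimage_closed => //.
by move=> z _; exact: cvg_snd.
Qed.

Lemma closed_section_sublevel (F : set Z) y c : closed F ->
  closed [set u | [/\ G (y, u), F u & g (y, u) <= c]].
Proof.
move=> cF; have -> : [set u | [/\ G (y, u), F u & g (y, u) <= c]] =
    (pair y) @^-1` (G `&` [set z | g z <= c]) `&` F.
  by apply/seteqP; split => u /= [] => [|[]].
apply: closedI => //; apply: preimage_closed => //.
by move=> u _; apply: cvg_pair; [exact: cvg_cst|exact: cvg_id].
Qed.

Lemma measurable_argmin : closed Y ->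
  exists sigma : T -> Z, measurable_fun (Y : set (borel T)) (sigma : borel T -> borel Z) /\
    forall y, Y y -> G (y, sigma y) /\ forall u, G (y, u) -> g (y, sigma y) <= g (y, u).
Proof.
move=> cY; pose v y := inf [set g (y, u) | u in [set u | G (y, u)]].
have v_lb y : has_lbound [set g (y, u) | u in [set u | G (y, u)]].
  exists (- M) => _ [u Gu <-].
  by have := gM Gu; rewrite ler_norml => /andP[].
have v_le y u : G (y, u) -> v y <= g (y, u).
  by move=> Gu; apply: ge_inf => //; exists u.
have v_lt y c : Y y -> v y < c -> exists2 u, G (y, u) & g (y, u) <= c.
  move=> Yy /inf_lt h; have [|_ [u Gu <-] /ltW] := h _; last by exists u.
  by have [u Gu] := G0 Yy; exists (g (y, u)), u.
pose A (F : set Z) c :=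
  Y `&` [set y | exists u, [/\ G (y, u), F u & g (y, u) <= c]].
pose argmin y := [set u | [/\ G (y, u), setT u & g (y, u) <= v y]].
(* A minimizer lies in F unless a rational level separates the minimum over F
   from the global one. *)
have hitsE F : closed F -> hits Y argmin F =
    Y `\` \bigcup_(q : rat) (A setT (ratr q) `\` A F (ratr q)).
  move=> cF; apply/seteqP; split => y.
    move=> [Yy [u [[Gu _ gu] Fu]]]; split => // -[q _ [[_ [u' [Gu' _ gu']]]]].
    apply; split => //; exists u; split => //.
    exact: le_trans gu (le_trans (v_le _ _ Gu') gu').
  move=> [Yy h]; split => //.
  (* If no rational level separates the two minima, [F] contains approximate minimizers for every
     tolerance [1 / (m + 1)]; compactness turns them into an exact one. *)
  pose N (m : nat) := [set u | [/\ G (y, u), F u & g (y, u) <= v y + m.+1%:R^-1]].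
  have [|||m|u uN] := @nested_compact Z setT N cZ => //.
  - by move=> m; exact: closed_section_sublevel.
  - move=> m u [? ? gu]; split => //; apply: (le_trans gu).
    by rewrite lerD2l lef_pV2 ?posrE// ler_nat.
  - have /rat_in_itvoo[q] : v y < v y + m.+1%:R^-1 by rewrite ltrDl invr_gt0.
    rewrite in_itv/= => /andP[vq qv].
    have [u0 Gu0 gu0] := v_lt y _ Yy vq.
    have : A F (ratr q) y.
      apply: contrapT => AF; apply: h; exists q => //; split => //.
      by split => //; exists u0.
    move=> [_ [u [Gu Fu gu]]]; exists u; split => //.
    exact: le_trans gu (ltW qv).
  - have [Gu Fu _] := uN 0%N I; exists u; split => //; split => //.
    apply/ler_addgt0Pr => e e0.
    have [m _ /(_ m (leqnn _)) me] := near_infty_natSinv_lt (PosNum e0).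
    by have [_ _ /le_trans] := uN m I; apply; rewrite lerD2l ltW.
have wM : weakly_measurable Y argmin.
  move=> F cF; rewrite hitsE//; apply: measurableD; first exact: closed_borel.
  apply: bigcupT_measurable_rat => q.
  by apply: measurableD; apply: closed_borel; exact: closed_proj_sublevel.
have [sigma [ms sP]] : exists sigma : T -> Z,
    measurable_fun (Y : set (borel T)) (sigma : borel T -> borel Z) /\
    forall y, Y y -> argmin y (sigma y).
  apply: weakly_measurable_selection => //; first exact: closed_borel.
  - by move=> y _; exact: closed_section_sublevel.
  - move=> y Yy; have : hits Y argmin setT y.
      by rewrite hitsE ?closedT// ; split => // -[q _ []].
    by move=> [_ [u []]]; exists u.
exists sigma; split => // y Yy; have [Gs _ gs] := sP y Yy; split => // u Gu.
exact: le_trans gs (v_le _ _ Gu).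
Qed.

End argmin.

(** * Joint measurability *)

(* The library does not join the pointed structures of products and matrices
   with their topological structures. *)
HB.instance Definition _ (X Z : ptopologicalType) := Pointed.on (X * Z)%type.
HB.instance Definition _ (R : realType) (X Z : pseudoPMetricType R) :=
  Pointed.on (X * Z)%type.
HB.instance Definition _ (R : realType) m n := Pointed.on 'M[R]_(m, n).

(** In general the Borel sigma-algebra of a product may be larger than the product sigma-algebra.
    Here both components range in compact sets, so the preimage of an open set is a countable union
    over products of balls centred on dense sequences. *)
Lemma measurable_fun_borel_pair (R : realType) d (O : measurableType d)
    (X Z : pseudoPMetricType R) (D : set O) (K1 : set X) (K2 : set Z)
    (x : O -> X) (u : O -> Z) :
  compact K1 -> compact K2 ->
  (forall w, D w -> K1 (x w)) -> (forall w, D w -> K2 (u w)) ->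
  measurable_fun D (x : O -> borel X) -> measurable_fun D (u : O -> borel Z) ->
  measurable_fun D ((fun w => (x w, u w)) : O -> borel (X * Z)%type).
Proof.
move=> cK1 cK2 xK uK mx mu.
have [->|/set0P[w0 Dw0]] := eqVneq D set0; first exact: measurable_fun_set0.
have [a _ aP] := compact_dense_seq cK1 (ex_intro _ _ (xK _ Dw0)).
have [b _ bP] := compact_dense_seq cK2 (ex_intro _ _ (uK _ Dw0)).
move=> mD; apply: (@measurability _ _ O (borel (X * Z)%type) D _ (@open (X * Z)%type)) => //.
move=> _ [B oB <-].
pose r (m : nat) : R := m.+1%:R^-1.
have r0 m : 0 < r m by rewrite invr_gt0.
pose I3 := [set p : nat * nat * nat |
  ball (a p.1.1) (r p.2) `*` ball (b p.1.2) (r p.2) `<=` B].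
have -> : D `&` (fun w => (x w, u w)) @^-1` B = \bigcup_(p in I3)
   ((D `&` x @^-1` (ball (a p.1.1) (r p.2))°) `&`
    (D `&` u @^-1` (ball (b p.1.2) (r p.2))°)).
  apply/seteqP; split => w /=; last first.
    move=> [[[i j] m] /= pB [[Dw xb] [_ ub]]]; split=> //.
    by apply: pB; split => /=; exact: interior_subset.
  move=> [Dw Bw].
  have /nbhs_ballP[e /= e0 eB] := open_nbhs_nbhs (conj oB Bw).
  have e2 : 0 < e / 2 :> R by rewrite divr_gt0.
  have [m _ /(_ m (leqnn _)) me] := near_infty_natSinv_lt (PosNum e2).
  (* Balls need not be open; a centre chosen within half the radius puts the point in the interior
     of the ball. *)
  have rm2 : 0 < r m / 2 by rewrite divr_gt0.
  have [i xi] := aP _ _ (xK w Dw) rm2.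
  have [j uj] := bP _ _ (uK w Dw) rm2.
  have int_ball (M : pseudoPMetricType R) (p q : M) : ball p (r m / 2) q -> (ball p (r m))° q.
    move=> pq; apply/nbhs_ballP; exists (r m / 2) => //= t qt.
    by rewrite (splitr (r m)); exact: ball_triangle pq qt.
  have sub_ball (M : pseudoPMetricType R) (p q t : M) :
      ball p (r m / 2) q -> ball p (r m) t -> ball q e t.
    move=> pq pt; rewrite (splitr e); apply: (@ball_triangle _ _ p).
      apply: ball_sym; apply: le_ball pq; apply: le_trans (ltW me).
      by rewrite -/(r m); have := r0 m; lra.
    by apply: le_ball pt; exact: ltW.
  exists ((i, j), m) => /=; last first.
    split; (split; first by []); [exact: int_ball xi|exact: int_ball uj].
  move=> [p q] /= [xp uq]; apply: eB; split => /=.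
    exact: sub_ball xi xp.
  exact: sub_ball uj uq.
rewrite bigcup_mkcond; apply: countable_bigcupT_measurable => // p.
case: ifP => // _.
apply: measurableI.
  by apply: mx => //; apply: sub_sigma_algebra; exact: open_interior.
by apply: mu => //; apply: sub_sigma_algebra; exact: open_interior.
Qed.

Lemma within_continuous_seq (T V : topologicalType) (G : set T) (h : T -> V)
    (u : nat -> T) z :
  {within G, continuous h} -> G z -> (forall i, G (u i)) -> u @ \oo --> z ->
  h (u i) @[i --> \oo] --> h z.
Proof.
move=> /subspace_continuousP ch Gz Gu uz; apply: (@cvg_comp _ _ _ u h _ _ _ _ (ch z Gz)).
move=> A /= /uz H; have {H} : \forall i \near \oo, G (u i) -> A (u i) by exact: H.
by apply: filterS => i; exact: (fun H => H (Gu i)).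
Qed.

Section caratheodory.
Context (R : realType) (Z : pseudoPMetricType R) d (S : measurableType d).
Context (G : set Z) (cG : compact G) (mG : measurable (G : set (borel Z))).

Lemma measurable_caratheodory (h : Z -> S -> R) :
  (forall x, {within G, continuous (h ^~ x)}) ->
  (forall z, G z -> measurable_fun setT (h z)) ->
  measurable_fun (G `*` setT : set (borel Z * S)%type)
    (fun p : borel Z * S => h p.1 p.2).
Proof.
move=> ch mh.
have [->|/set0P[z0 Gz0]] := eqVneq G set0.
  by rewrite set0X; exact: measurable_fun_set0.
have [a aG aP] := compact_dense_seq cG (ex_intro _ _ Gz0).
pose r (m : nat) : R := m.+1%:R^-1.
have r0 m : 0 < r m by rewrite invr_gt0.
pose b m j := (ball (a j) (r m))°.
(* h (z, x) is the limit of h (a j, x), where j is the first index with a j within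
   1 / (m + 1) of z. *)
have ex_idx (p : nat * Z) : exists j, G p.2 -> b p.1 j p.2 /\
    forall i, (i < j)%N -> ~ b p.1 i p.2.
  case: p => m z /=; have [Gz|] := pselect (G z); last by exists 0%N.
  have ex : exists j, `[< b m j z >].
    have rm2 : 0 < r m / 2 by rewrite divr_gt0.
    have [j zj] := aP z _ Gz rm2; exists j; apply/asboolP.
    apply/nbhs_ballP; exists (r m / 2) => //= t zt.
    by rewrite (splitr (r m)); exact: ball_triangle zj zt.
  case: (ex_minnP ex) => j /asboolP bj jmin; exists j => _; split => // i ij.
  by move=> /asboolP/jmin; rewrite leqNgt ij.
have [idx' idx'P] := choice ex_idx; pose idx m z := idx' (m, z).
have idxP m z : G z -> b m (idx m z) z /\ forall i, (i < idx m z)%N -> ~ b m i z.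
  by move=> Gz; exact: (idx'P (m, z)).
have idx_cell m j : G `&` [set z | idx m z = j] =
    G `&` b m j `\` \bigcup_(i in [set i | (i < j)%N]) b m i.
  apply/seteqP; split => z /=.
    move=> [Gz <-]; have [? lt] := idxP m z Gz; split => // -[i /= ij].
    exact: lt.
  move=> [[Gz bj] nb]; split => //; have [bi lt] := idxP m z Gz.
  have [ij|ji|//] := ltngtP (idx m z) j; last by have := lt _ ji.
  by exfalso; apply: nb; exists (idx m z).
apply: (@measurable_fun_cvg _ _ _ _ (fun m (p : borel Z * S) => h (a (idx m p.1)) p.2)).
  move=> m mD B mB.
  have -> : (G `*` setT) `&` (fun p : borel Z * S => h (a (idx m p.1)) p.2) @^-1` B =
      \bigcup_j ((G `&` [set z | idx m z = j]) `*` (setT `&` h (a j) @^-1` B)).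
    apply/seteqP; split => -[z x] /=.
      by move=> [[Gz _] hB]; exists (idx m z).
    by move=> [j _ [/= [Gz ij] [_ hB]]]; split => //; rewrite ij.
  apply: bigcupT_measurable => j; apply: measurableX; last first.
    by apply: mh => //; exact: aG.
  rewrite idx_cell; apply: measurableD.
    by apply: measurableI => //; apply: sub_sigma_algebra; exact: open_interior.
  apply: bigcup_measurable => i _; apply: sub_sigma_algebra; exact: open_interior.
move=> [z x] [/= Gz _]; apply: (within_continuous_seq (ch x) Gz) => //.
apply/cvg_ballP => e e0; near=> m.
have [/interior_subset bz _] := idxP m z Gz; apply: ball_sym.
apply: le_ball bz; apply: ltW; near: m; exact: (near_infty_natSinv_lt (PosNum e0)).
Unshelve. all: by end_near. Qed.

Lemma measurable_caratheodory_borel (V : normedModType R) (F : Z -> S -> V) :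
  (forall x, {within G, continuous (F ^~ x)}) ->
  (forall z, G z -> measurable_fun setT (F z : S -> borel V)) ->
  measurable_fun (G `*` setT : set (borel Z * S)%type)
    ((fun p : borel Z * S => F p.1 p.2) : _ -> borel V).
Proof.
move=> cF mF mD; apply: (@measurability _ _ _ (borel V) _ _ (@open V)) => //.
move=> _ [B oB <-].
have [C0|/set0P C0] := eqVneq (~` B) set0.
  rewrite -(setCK B) C0 setC0 preimage_setT setIT; exact: measurableX.
have gC y : (~` B) y -> 0 <= (fun _ : V => 0 : R) y by [].
(* This is the distance to the complement of [B]. It is continuous and positive exactly on [B],
   which reduces the claim to real-valued functions. *)
pose phi := inf_conv (~` B) (fun=> 0 : R) 1.
have phi_cont : continuous phi by exact: (continuous_inf_conv C0 gC).
have phi_gt0 y : B y = (0 < phi y) :> Prop.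
  rewrite propeqE; split => [By|phi0].
    have /nbhs_ballP[e /= e0 eB] := open_nbhs_nbhs (conj oB By).
    apply: lt_le_trans e0 _; apply: le_inf_conv => // t nBt.
    rewrite add0r mul1r leNgt; apply/negP => yt; apply: nBt.
    by apply: eB; rewrite -ball_normE.
  apply: contrapT => nBy; move: phi0; rewrite ltNge => /negP; apply.
  by have := inf_conv_le gC 1 y nBy; rewrite subrr normr0 mulr0 addr0.
have mphi : measurable_fun setT (phi : borel V -> R).
  apply: lsc_on_measurable; apply: continuous_lsc_on => //.
  exact: continuous_subspaceT.
have -> : (fun p : borel Z * S => F p.1 p.2) @^-1` B =
    (fun p : borel Z * S => phi (F p.1 p.2)) @^-1` `]0, +oo[%classic.
  by apply/seteqP; split => p /=; rewrite in_itv/= andbT phi_gt0.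
apply: (measurable_caratheodory (h := fun z x => phi (F z x))) => //.
  move=> x z; apply: (@continuous_comp (subspace G) V R (F ^~ x) phi z (cF x z)).
  exact: phi_cont.
by move=> z Gz; apply: (measurableT_comp mphi); exact: mF.
Qed.

End caratheodory.

(** * Independence *)

Section independence.
Context d (Om : measurableType d) (R : realType) (P : probability Om R).
Context d1 (E1 : measurableType d1) d2 (E2 : measurableType d2).
Context (X : Om -> E1) (V : Om -> E2).
Hypotheses (mX : measurable_fun setT X) (mV : measurable_fun setT V).

(** Dynkin's argument: measurable rectangles form a generating pi-system, and the sets [C]
    satisfying the product rule with [H] form a Dynkin system. In the application [H] is an event
    about the later noise. *)
Lemma indep_rectangles (H : set Om) : measurable H ->
  (forall A B, measurable A -> measurable B ->
    (P (X @^-1` A `&` V @^-1` B `&` H) = P (X @^-1` A `&` V @^-1` B) * P H)%E) ->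
  forall C, measurable C ->
    (P ((fun w => (X w, V w)) @^-1` C `&` H) = P ((fun w => (X w, V w)) @^-1` C) * P H)%E.
Proof.
move=> mH rect C mC.
have mXV : measurable_fun setT (fun w => (X w, V w)) by exact: measurable_fun_pair.
have pre A : measurable A -> measurable ((fun w => (X w, V w)) @^-1` A).
  by move=> mA; rewrite -[_ @^-1` _]setTI; exact: mXV.
move: C mC; rewrite measurable_prod_measurableType.
apply: dynkin_induction => /=.
- by rewrite measurable_prod_measurableType.
- move=> _ _ [A1 mA1 [A2 mA2 <-]] [B1 mB1 [B2 mB2 <-]].
  exists (A1 `&` B1); first exact: measurableI.
  exists (A2 `&` B2); first exact: measurableI.
  by rewrite setXI.
- by rewrite preimage_setT setTI probability_setT mul1e.
- by move=> _ [A mA [B mB <-]]; exact: rect.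
- move=> C mC HC; rewrite preimage_setC probability_setC; last exact: pre.
  rewrite setIC -setDE measureD//; last 2 first.
  + exact: pre.
  + by rewrite -ge0_fin_numE ?fin_num_measure.
  rewrite [X in (_ - P X)%E]setIC HC muleBl ?mul1e ?fin_num_measure ?fin_num_adde_defr//.
- move=> F mF tF HF; rewrite preimage_bigcup setI_bigcupl.
  have tF' : trivIset setT (fun k => (fun w => (X w, V w)) @^-1` F k).
    apply/trivIsetP => i j _ _ ij; rewrite -preimage_setI.
    by move/trivIsetP : tF => /(_ i j I I ij) ->; rewrite preimage_set0.
  rewrite measure_bigcup; last 2 first.
  + by move=> k _; apply: measurableI => //; exact: pre.
  + apply/trivIsetP => i j _ _ ij; rewrite setIACA.
    by move/trivIsetP : tF' => /(_ i j I I ij) ->; rewrite set0I.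
  rewrite measure_bigcup//; last by move=> k _; exact: pre.
  rewrite (eq_eseriesr
    (g := fun k => (fine (P H))%:E * P ((fun w => (X w, V w)) @^-1` F k))%E).
    by rewrite nneseriesZl// fineK ?fin_num_measure// muleC.
  by move=> k _; rewrite fineK ?fin_num_measure// muleC; exact: HF.
Qed.

Hypothesis XV : forall A B, measurable A -> measurable B ->
  (P (X @^-1` A `&` V @^-1` B) = P (X @^-1` A) * P (V @^-1` B))%E.

(** Freezing: by independence the law of [(X, V)] is the product of the marginal laws, so Fubini
    integrates [V] out while [X] stays fixed. *)
Lemma Rintegral_indep (G : set E1) (h : E1 * E2 -> R) (M : R) :
  measurable G -> measurable_fun (G `*` setT) h ->
  (forall p, G p.1 -> `|h p| <= M) -> (forall w, G (X w)) ->
  \int[P]_w h (X w, V w) = \int[P]_w \int[P]_w' h (X w, V w').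
Proof.
move=> mG mh hM GX.
(* Measurability and the bound are only known over [G]; extension by zero makes them global and
   changes nothing along [X], which stays in [G]. *)
pose h' := h \_ (G `*` setT).
have h'E w w' : h' (X w, V w') = h (X w, V w').
  rewrite /h' patchE ifT//; apply/mem_set; split => //=; exact: GX.
have mh' : measurable_fun setT h'.
  exact: (measurable_restrictT h (measurableX mG measurableT)).1 mh.
have h'M p : `|h' p| <= `|M|.
  rewrite /h' patchE; case: ifPn => [/set_mem[Gp _]|_]; last by rewrite normr0.
  exact: le_trans (hM _ Gp) (ler_norm _).
have mXV : measurable_fun setT (fun w => (X w, V w)) by exact: measurable_fun_pair.
pose fX : {mfun Om >-> E1} :=
  MeasurableFun.Pack (MeasurableFun.Class (isMeasurableFun.Build _ _ _ _ _ mX)).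
pose fV : {mfun Om >-> E2} :=
  MeasurableFun.Pack (MeasurableFun.Class (isMeasurableFun.Build _ _ _ _ _ mV)).
pose fXV : {mfun Om >-> (E1 * E2)%type} :=
  MeasurableFun.Pack (MeasurableFun.Class (isMeasurableFun.Build _ _ _ _ _ mXV)).
under eq_Rintegral do rewrite -h'E.
under [RHS]eq_Rintegral do under eq_Rintegral do rewrite -h'E.
have int_comp (Q : probability (E1 * E2)%type R) : Q.-integrable setT (EFin \o h').
  by apply: (@bounded_integrable _ _ _ Q setT h' `|M|).
have eF w : fubini_F (distribution P fV) (EFin \o h') (X w) = (\int[P]_w' h' (X w, V w'))%:E.
  rewrite /fubini_F integral_distribution.
  - apply: (@EFin_Rintegral _ _ _ P setT (fun w' => h' (X w, V w')) `|M|) => //.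
    by apply: (measurableT_comp mh'); apply: measurable_fun_pair.
  - by apply/measurable_EFinP; apply: (measurableT_comp mh'); apply: measurable_fun_pair.
  - apply: (@bounded_integrable _ _ _ P setT (fun w' => h' (X w, V w')) `|M|) => //.
    by apply: (measurableT_comp mh'); apply: measurable_fun_pair.
rewrite /Rintegral; congr fine.
transitivity (\int[distribution P fXV]_p (h' p)%:E)%E.
  rewrite integral_distribution//; first exact/measurable_EFinP.
  apply: (@bounded_integrable _ _ _ P setT (fun w => h' (X w, V w)) `|M|) => //.
  exact: (measurableT_comp mh').
have imf : (distribution P fX \x distribution P fV)%E.-integrable setT (EFin \o h').
  apply: measurable_bounded_integrable => //.
    rewrite -setXTT [X in (X < _)%E]product_measure1E//.
    have pX : distribution P fX setT = 1%E by exact: probability_setT.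
    have pV : distribution P fV setT = 1%E by exact: probability_setT.
    by rewrite /= pX pV mule1 ltry.
  exists `|M|; split; first exact: num_real.
  by move=> N MN p _ /=; exact: le_trans (h'M p) (ltW MN).
transitivity (\int[(distribution P fX \x distribution P fV)%E]_p (h' p)%:E)%E.
  by apply: eq_measure_integral => A mA _; apply/esym/product_measure_unique.
rewrite -[LHS](integral12_prod_meas1 imf).
have eFw : EFin \o (fun w => \int[P]_w' h' (X w, V w')) =
    fubini_F (distribution P fV) (EFin \o h') \o fX.
  by apply/funext => w /=; rewrite eF.
have mF := measurable_fubini_F imf.
rewrite integral_distribution//.
  by apply: eq_integral => w _; exact: eF.
rewrite -eFw; apply: (@bounded_integrable _ _ _ P setT _ `|M|) => //.
  by apply/measurable_EFinP; rewrite eFw; exact: measurableT_comp.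
move=> w _; apply: prob_Rintegral_bound => //.
by apply: (measurableT_comp mh'); apply: measurable_fun_pair.
Qed.



End independence.

(** * Averages of eventually periodic sequences *)

Section periodic_mean.
Context (R : realType) (c : nat -> R) (T0 p : nat).
Hypotheses (p_gt0 : (0 < p)%N) (c_per : forall t, (T0 <= t)%N -> c (t + p)%N = c t).

Let L : R := p%:R^-1 * \sum_(i < p) c (T0 + i)%N.

(** Sliding the window by one step drops [c N] and adds [c (N + p)], which are equal. *)
Lemma periodic_block T : (T0 <= T)%N -> \sum_(i < p) c (T + i)%N = L *+ p.
Proof.
have p_neq0 : p%:R != 0 :> R by rewrite pnatr_eq0 -lt0n.
move=> /subnK <-; elim: (T - T0)%N => [|m IH].
  by rewrite add0n /L -[RHS]mulr_natl mulVKf.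
rewrite -IH; set N := (m + T0)%N.
have E1 : \sum_(i < p.+1) c (N + i)%N = \sum_(i < p) c (N + i)%N + c N.
  by rewrite big_ord_recr /= c_per// leq_addl.
have E2 : \sum_(i < p.+1) c (N + i)%N = c N + \sum_(i < p) c (N.+1 + i)%N.
  rewrite big_ord_recl /= addn0; congr (_ + _).
  by apply: eq_bigr => i _; rewrite /bump /= add1n addnS.
by move: E1; rewrite E2 addrC => /addIr.
Qed.

(** The deviation [D T] of the partial sum from [L *+ T] is itself periodic from [T0] on, hence
    bounded by the sum of its absolute values over the first [T0 + p] indices, and is negligible
    after division by [T]. *)
Lemma cvg_periodic_mean :
  T%:R^-1 * \sum_(t < T) c t @[T --> \oo] --> L.
Proof.
pose D T : R := \sum_(t < T) c t - L *+ T.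
have D_per T : (T0 <= T)%N -> D (T + p)%N = D T.
  move=> T0T; rewrite /D big_split_ord /= periodic_block// mulrnDr; lra.
pose B := \sum_(t < T0 + p) `|D t|.
have DB T : `|D T| <= B.
  have [m] := ubnP T; elim: m T => // m IH T; rewrite ltnS => Tm.
  have [TT|TT] := ltnP T (T0 + p)%N.
    rewrite /B (bigD1 (Ordinal TT))//= lerDl; exact: sumr_ge0.
  have pT : (p <= T)%N by rewrite (leq_trans _ TT)// leq_addl.
  rewrite -(subnK pT) D_per; last by rewrite leq_subRL// addnC.
  apply: IH; apply: leq_trans Tm; rewrite ltn_subrL p_gt0 (leq_trans p_gt0)//.
apply/cvgrPdist_le => e e0; near=> T.
have T_gt0 : (0 < T)%N by near: T; exact: nbhs_infty_gt.
have TR : 0 < T%:R :> R by rewrite ltr0n.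
have -> : L - T%:R^-1 * \sum_(t < T) c t = - (T%:R^-1 * D T).
  by rewrite /D mulrBr -[L *+ T]mulr_natl mulKf ?gt_eqF// opprB.
rewrite normrN normrM gtr0_norm ?invr_gt0// ler_pdivrMl//.
apply: le_trans (DB T) _; rewrite -ler_pdivrMr//.
near: T; exact: nbhs_infty_ger.
Unshelve. all: by end_near. Qed.

End periodic_mean.

Section distribution_on.
Context d d' (Om : measurableType d) (E : measurableType d') (R : realType).
Context (P : probability Om R) (X : {mfun Om >-> E}) (G : set E).
Hypotheses (mG : measurable G) (GX : forall w, G (X w)).

Lemma distribution_off : distribution P X (~` G) = 0%E.
Proof.
rewrite /distribution /pushforward (_ : _ @^-1` _ = set0) ?measure0//.
by rewrite -subset0 => w /=; apply; exact: GX.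
Qed.

Lemma Rintegral_distribution_on (g : E -> R) M : measurable_fun G g ->
  (forall x, G x -> `|g x| <= M) ->
  \int[distribution P X]_(x in G) g x = \int[P]_w g (X w).
Proof.
move=> mg gM; rewrite Rintegral_mkcond /Rintegral; congr fine.
have mg' := (measurable_restrictT g mG).1 mg.
have gX w : (g \_ G) (X w) = g (X w).
  by rewrite patchE ifT//; exact/mem_set/GX.
rewrite (integral_distribution (f := EFin \o (g \_ G))).
- by apply: eq_integral => w _ /=; rewrite gX.
- exact/measurable_EFinP.
- apply: (@prob_bounded_integrable _ _ _ P ((g \_ G) \o X) M).
    exact: measurableT_comp.
  by move=> w /=; rewrite gX; exact: gM.
Qed.

End distribution_on.

Lemma telescope_shift (R : realType) (e : nat -> R) a m :
  \sum_(i < m) (e (a + i).+1 - e (a + i)%N) = e (a + m)%N - e a.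
Proof.
elim: m => [|m IH]; first by rewrite big_ord0 addn0 subrr.
by rewrite big_ord_recr /= IH addnS; lra.
Qed.

(** * The control system *)

Lemma compact_continuous_bounded (R : realType) (T : topologicalType) (A : set T)
    (g : T -> R) : compact A -> {within A, continuous g} ->
  exists2 M, 0 <= M & forall x, A x -> `|g x| <= M.
Proof.
move=> cA cg; have [M [_ gM]] := compact_bounded (continuous_compact cg cA).
exists (`|M| + 1) => [|x Ax]; first by rewrite addr_ge0.
by apply: gM; [rewrite ltr_pwDr// ler_norm|exists x].
Qed.

Lemma within_continuous_fst (T1 T2 V : topologicalType) (A : set T1) (B : set T2)
    (g : T1 -> V) :
  {within A, continuous g} -> {within A `*` B, continuous (fun z => g z.1)}.
Proof.
move=> /subspace_continuousP cg; apply/subspace_continuousP => v [Av _].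
apply: (@cvg_comp _ _ _ fst g _ (within A (nbhs v.1))); last exact: cg.
move=> N /= HN.
have cfst : z.1 @[z --> v] --> v.1 by exact: cvg_fst.
have H : \forall z \near v, A z.1 -> N z.1 by exact: (cfst _ HN).
by apply: filterS H => z h [Az _]; exact: h.
Qed.

Section control_system_theory.
Context (R : realType) d (Om : measurableType d) (P : probability Om R).
Context (n : nat) (Uhat : pmetricType R) (S : completeMetricType R).

Local Notation X := 'rV[R]_n.

Context (Y : set X) (U : X -> set Uhat) (f : X -> Uhat -> S -> X).
Context (s : nat -> {RV P >-> borel S}) (k : X * Uhat -> R).
Hypotheses (Y_compact : compact Y) (Uhat_compact : compact [set: Uhat])
  (f_continuous : forall x : S,
     {within Y `*` [set: Uhat], continuous (fun z => f z.1 z.2 x)})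
  (f_measurable : forall y u, Y y ->
     measurable_fun [set: borel S] (f y u : borel S -> borel X))
  (s_iid : iid s)
  (U_neq0 : forall y, Y y -> U y !=set0)
  (U_compact : forall y, Y y -> compact (U y))
  (U_usc : upper_semicontinuous_on Y U)
  (f_viable : forall y u x, Y y -> U y u -> Y (f y u x)).

Local Notation G := (graph Y U).

Let closedY : closed Y.
Proof. by apply: compact_closed => //; exact: norm_hausdorff. Qed.

(** If [u] is not in [U y], some neighbourhood of [u] has closure disjoint from the compact [U y];
    upper semicontinuity keeps that closure disjoint from [U y'] for [y'] in [Y] near [y], so points
    of the graph cannot converge to [(y, u)]. *)
Lemma closed_graph : closed G.
Proof.
move=> [y u] /closure_seq[z zG zyu].
have z1 : (z i).1 @[i --> \oo] --> y by apply: (cvg_comp _ _ zyu); exact: cvg_fst.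
have z2 : (z i).2 @[i --> \oo] --> u by apply: (cvg_comp _ _ zyu); exact: cvg_snd.
have Yy : Y y.
  by apply: (closed_cvg _ closedY _ _ z1); apply: nearW => i; have [] := zG i.
split => //=; apply: contrapT => nUu.
have clU : closed (U y) by apply: compact_closed; [exact: metric_hausdorff|exact: U_compact].
have [N Nu NU] : exists2 N, nbhs u N & closure N `<=` ~` U y.
  apply: (@uniform_regular _ u); apply: open_nbhs_nbhs.
  by split => //; exact: closed_openC.
have UV : U y `<=` ~` closure N by move=> v Uv /NU.
have := U_usc Yy (closed_openC (@closed_closure _ N)) UV.
rewrite near_withinE => /z1 H.
have /filter_ex[i [H1 H2]] : \forall i \near \oo,
    (Y (z i).1 -> U (z i).1 `<=` ~` closure N) /\ N (z i).2.
  by apply: filterI; [exact: H|exact: z2].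
have [Yi Ui] := zG i.
by apply: (H1 Yi _ Ui); exact: subset_closure.
Qed.

Lemma compact_graph : compact G.
Proof.
apply: (subclosed_compact closed_graph (compact_setX Y_compact Uhat_compact)).
by move=> z [].
Qed.

Let measurable_graph : measurable (G : set (borel (X * Uhat)%type)).
Proof. exact: closed_borel closed_graph. Qed.

Let measurableY : measurable (Y : set (borel X)).
Proof. exact: closed_borel closedY. Qed.

Let GYT : G `<=` Y `*` [set: Uhat].
Proof. by move=> z []. Qed.

Lemma measurable_dynamics :
  measurable_fun (G `*` setT : set (borel (X * Uhat)%type * borel S)%type)
  ((fun p : borel (X * Uhat)%type * borel S => f p.1.1 p.1.2 p.2) : _ -> borel X).
Proof.
have cf x : {within G, continuous (fun z : X * Uhat => f z.1 z.2 x)}.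
  exact: (continuous_subspaceW GYT (@f_continuous x)).
have mf z : G z -> measurable_fun setT (f z.1 z.2 : borel S -> borel X).
  by move=> [Yz _]; exact: f_measurable.
have H := @measurable_caratheodory_borel R (X * Uhat)%type _ (borel S) G
  compact_graph measurable_graph X (fun z x => f z.1 z.2 x) cf mf.
exact: H.
Qed.

(** The transition operator of the controlled chain, real-valued for arithmetic and limits; on [G],
    for bounded measurable [phi], [drift] is this operator minus [phi]. *)
Definition EX (phi : X -> R) (z : X * Uhat) : R :=
  \int[P]_w phi (f z.1 z.2 (s 0%N w)).

Lemma measurable_next (phi : X -> R) z :
  measurable_fun (Y : set (borel X)) (phi : borel X -> R) -> G z ->
  measurable_fun setT ((fun x => phi (f z.1 z.2 x)) : borel S -> R).
Proof.
move=> mphi [Yz Uz].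
apply: (measurable_comp measurableY _ mphi (@f_measurable z.1 z.2 Yz)).
by move=> _ [x _ <-]; exact: f_viable.
Qed.

Lemma measurable_next_noise (phi : X -> R) z t :
  measurable_fun (Y : set (borel X)) (phi : borel X -> R) -> G z ->
  measurable_fun setT (fun w => phi (f z.1 z.2 (s t w))).
Proof.
by move=> mphi Gz; apply: (measurableT_comp (measurable_next mphi Gz)).
Qed.

Lemma bounded_next (phi : X -> R) M z x : (forall y, Y y -> `|phi y| <= M) -> G z ->
  `|phi (f z.1 z.2 x)| <= M.
Proof. by move=> phiM [Yz Uz]; apply: phiM; exact: f_viable. Qed.

Lemma EX_bound (phi : X -> R) M z :
  measurable_fun (Y : set (borel X)) (phi : borel X -> R) ->
  (forall y, Y y -> `|phi y| <= M) -> G z -> `|EX phi z| <= M.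
Proof.
move=> mphi phiM Gz; apply: prob_Rintegral_bound.
  exact: measurable_next_noise.
by move=> w; exact: bounded_next.
Qed.

Lemma driftE (phi : X -> R) M z :
  measurable_fun (Y : set (borel X)) (phi : borel X -> R) ->
  (forall y, Y y -> `|phi y| <= M) -> G z -> drift f s phi z = (EX phi z - phi z.1)%:E.
Proof.
move=> mphi phiM Gz; rewrite /drift unlock EFinB; congr (_ - _)%E.
apply: (@EFin_Rintegral _ _ _ P setT (fun w => phi (f z.1 z.2 (s 0%N w))) M) => //.
  exact: measurable_next_noise.
by move=> w _; exact: bounded_next.
Qed.

Lemma EX_noise (phi : X -> R) M z t :
  measurable_fun (Y : set (borel X)) (phi : borel X -> R) ->
  (forall y, Y y -> `|phi y| <= M) -> G z ->
  \int[P]_w phi (f z.1 z.2 (s t w)) = EX phi z.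
Proof.
move=> mphi phiM Gz; rewrite /EX /Rintegral; congr fine.
have mg := measurable_next mphi Gz.
have law i : (\int[P]_w (phi (f z.1 z.2 (s i w)))%:E)%E =
    (\int[distribution P (s i)]_x (phi (f z.1 z.2 x))%:E)%E.
  rewrite integral_distribution//; first exact/measurable_EFinP.
  apply: (@bounded_integrable _ _ _ P setT (fun w => phi (f z.1 z.2 (s i w))) M) => //.
    exact: measurable_next_noise.
  by move=> w _; exact: bounded_next.
rewrite !law; apply: eq_measure_integral => A mA _; exact: s_iid.2.
Qed.

Lemma EX_cvg (phi_ : nat -> X -> R) (phi : X -> R) M z :
  (forall j, measurable_fun (Y : set (borel X)) (phi_ j : borel X -> R)) ->
  (forall j y, Y y -> `|phi_ j y| <= M) ->
  (forall y, Y y -> phi_ j y @[j --> \oo] --> phi y) -> G z ->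
  EX (phi_ j) z @[j --> \oo] --> EX phi z.
Proof.
move=> mphi phiM phi_cvg Gz; apply: (bounded_cvg_Rintegral (M := M)) => //.
- by move=> j; exact: measurable_next_noise.
- by move=> j w _; exact: (bounded_next _ (phiM j) Gz).
- by move=> w _; apply: phi_cvg; case: Gz => ? ?; exact: f_viable.
Qed.

Lemma EX_seq (phi : X -> R) M (z_ : nat -> X * Uhat) z :
  {within Y, continuous phi} -> (forall y, Y y -> `|phi y| <= M) ->
  (forall i, G (z_ i)) -> G z -> z_ @ \oo --> z ->
  EX phi (z_ i) @[i --> \oo] --> EX phi z.
Proof.
move=> cphi phiM Gz_ Gz zz.
have mphi := lsc_on_measurable (continuous_lsc_on closedY cphi).
apply: (bounded_cvg_Rintegral (M := M)) => //.
- by move=> i; exact: measurable_next_noise.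
- by move=> i w _; exact: (bounded_next _ phiM (Gz_ i)).
- move=> w _.
  have Yf v : G v -> Y (f v.1 v.2 (s 0%N w)) by move=> [? ?]; exact: f_viable.
  apply: (within_continuous_seq (u := fun i => f (z_ i).1 (z_ i).2 (s 0%N w)) cphi).
  + exact: Yf.
  + by move=> i; exact: Yf.
  + by apply: (within_continuous_seq (@f_continuous (s 0%N w))) zz => [|i]; exact: GYT.
Qed.

(** For continuous [phi] the function [EX phi] is continuous along sequences in [G]. With continuous
    [phi j] below [V] converging to it, a sublevel set for [V] is the intersection of the closed
    ones for the [phi j]. *)
Lemma lsc_on_cost_EX (c : X * Uhat -> R) (V : X -> R) M :
  {within G, continuous c} -> lsc_on Y V -> (forall y, Y y -> `|V y| <= M) ->
  lsc_on G (fun z => c z + EX V z).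
Proof.
move=> cc lV VM a.
have [->|/set0P[z0 Gz0]] := eqVneq G set0; first by rewrite set0I; exact: closed0.
have Y0 : Y !=set0 by exists z0.1; case: Gz0.
have [phi [cphi phiM phiV phi_cvg]] := lsc_approx Y0 VM lV.
have cphiY j : {within Y, continuous (phi j)} by apply: continuous_subspaceT; exact: cphi.
have mphi j := lsc_on_measurable (continuous_lsc_on closedY (cphiY j)).
have mV := lsc_on_measurable lV.
have -> : G `&` [set z | c z + EX V z <= a] =
    \bigcap_j (G `&` [set z | c z + EX (phi j) z <= a]).
  apply/seteqP; split => z /=.
    move=> [Gz za] j _; split => //; apply: le_trans za; rewrite lerD2l.
    apply: le_Rintegral => //.
    - apply: (@bounded_integrable _ _ _ P setT _ M) => //; first exact: measurable_next_noise.
      by move=> w _; exact: (bounded_next _ (phiM j) Gz).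
    - apply: (@bounded_integrable _ _ _ P setT _ M) => //; first exact: measurable_next_noise.
      by move=> w _; exact: (bounded_next _ VM Gz).
    - by move=> w _; apply: phiV; case: Gz => ? ?; exact: f_viable.
  move=> h; have [Gz _] := h 0%N I; split => //.
  have H : c z + EX (phi j) z @[j --> \oo] --> c z + EX V z.
    by apply: cvgD; [exact: cvg_cst|exact: (EX_cvg mphi phiM phi_cvg Gz)].
  apply: (closed_cvg _ (closed_le (y := a)) _ _ H).
  by apply: nearW => j; have [] := h j I.
apply: closed_bigI => j _ z /closure_seq[z_ zP zz].
have Gz_ i : G (z_ i) by have [] := zP i.
have Gz : G z by apply: (closed_cvg _ closed_graph _ _ zz); exact: nearW.
split => //=.
have H : c (z_ i) + EX (phi j) (z_ i) @[i --> \oo] --> c z + EX (phi j) z.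
  apply: cvgD; first exact: (within_continuous_seq cc Gz Gz_ zz).
  exact: (EX_seq (cphiY j) (phiM j) Gz_ Gz zz).
apply: (closed_cvg _ (closed_le (y := a)) _ _ H).
by apply: nearW => i; have [] := zP i.
Qed.

(** * Trajectories of a plan: measurability, independence, Markov property *)

Section plan.
Context (pi : nat -> X -> Uhat) (pi_plan : plan Y U pi) (y0 : X) (Yy0 : Y y0).
Local Notation st := (state f s pi y0).
Local Notation z t := (fun w => (st t w, control f s pi y0 t w)).

Lemma graph_selection t y : Y y -> G (y, pi t y).
Proof. by move=> Yy; split => //=; apply: (pi_plan t).2. Qed.

Lemma state_viable t w : Y (st t w).
Proof.
elim: t => [//|t IH] /=; apply: f_viable => //.
by have [] := graph_selection t IH.
Qed.

Lemma pair_viable t w : G (z t w).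
Proof. exact/graph_selection/state_viable. Qed.

Lemma measurable_graph_selection t :
  measurable_fun (Y : set (borel X))
    ((fun y => (y, pi t y)) : borel X -> borel (X * Uhat)%type).
Proof.
apply: (@measurable_fun_borel_pair R _ (borel X) X Uhat Y Y setT id (pi t)) => //.
exact: (pi_plan t).1.
Qed.

Lemma measurable_state t : measurable_fun setT (st t : Om -> borel X).
Proof.
elim: t => [|t IH]; first exact: measurable_cst.
have mz : measurable_fun setT (z t : Om -> borel (X * Uhat)%type).
  apply: (measurable_comp measurableY _ (measurable_graph_selection t) IH).
  by move=> _ [w _ <-]; exact: state_viable.
have mzs : measurable_fun setT (fun w => (z t w, s t w) : borel (X * Uhat)%type * borel S).
  by apply: measurable_fun_pair => //; exact: measurable_funP.
apply: (measurable_comp _ _ measurable_dynamics mzs).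
  exact: measurableX.
by move=> _ [w _ <-]; split => //; exact: pair_viable.
Qed.

Lemma measurable_pair t : measurable_fun setT (z t : Om -> borel (X * Uhat)%type).
Proof.
apply: (measurable_comp measurableY _ (measurable_graph_selection t) (measurable_state t)).
by move=> _ [w _ <-]; exact: state_viable.
Qed.

(** Induction on [t], for all finite families of noise indices from [t] on at once: the state at
    [t.+1] is a function of the state and the noise at [t], so the step applies the hypothesis at
    [t] to a family enlarged by the index [t]. *)
Lemma state_indep t (J : seq nat) (B : nat -> set (borel S)) :
  uniq J -> (forall j, j \in J -> (t <= j)%N) -> (forall j, measurable (B j)) ->
  forall A : set (borel X), measurable A ->
  (P (st t @^-1` A `&` \bigcap_(j in [set` J]) (s j @^-1` B j)) =
   P (st t @^-1` A) * P (\bigcap_(j in [set` J]) (s j @^-1` B j)))%E.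
Proof.
pose E (J : seq nat) (B : nat -> set (borel S)) := \bigcap_(j in [set` J]) (s j @^-1` B j).
have ms j (B0 : set (borel S)) : measurable B0 -> measurable (s j @^-1` B0).
  by move=> mB0; exact: measurable_funPTI.
elim: t J B => [|t IH] J B uJ geJ mB A mA.
  have [Ay0|Ay0] := pselect (A y0).
    have -> : st 0%N @^-1` A = setT by apply/seteqP; split.
    by rewrite setTI probability_setT mul1e.
  have -> : st 0%N @^-1` A = set0 by apply/seteqP; split.
  by rewrite set0I measure0 mul0e.
have mE (J' : seq nat) B' : (forall j, measurable (B' j)) -> measurable (E J' B').
  by move=> mB'; apply: bigcap_measurableType => j _; exact: ms.
have tJ : t \notin J by apply/negP => /geJ; rewrite ltnn.
pose C : set (borel (X * Uhat)%type * borel S)%type :=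
  (G `*` setT) `&` (fun p : borel (X * Uhat)%type * borel S => f p.1.1 p.1.2 p.2) @^-1` A.
have mC : measurable C by apply: measurable_dynamics => //; exact: measurableX.
have -> : st t.+1 @^-1` A = (fun w => (z t w, s t w)) @^-1` C.
  apply/seteqP; split => w /=; last by move=> [].
  by move=> Aw; split => //; split => //; exact: pair_viable.
apply: (@indep_rectangles _ Om R P _ (borel (X * Uhat)%type) _ (borel S) (z t) (s t)) => //.
- exact: measurable_pair.
- exact: mE.
move=> A1 B1 mA1 mB1.
pose A2 : set (borel X) := Y `&` (fun y => (y, pi t y)) @^-1` A1.
have mA2 : measurable A2 by exact: measurable_graph_selection.
have -> : (fun w => z t w) @^-1` A1 = st t @^-1` A2.
  apply/seteqP; split => w /=; last by move=> [].
  by move=> ?; split => //; exact: state_viable.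
(* Placing [B1] at index [t] merges the condition on the present noise with those on the later noise
   into one event of the same form. *)
pose B' j := if j == t then B1 else B j.
have mB' j : measurable (B' j) by rewrite /B'; case: ifP.
have EB' : E (t :: J) B' = s t @^-1` B1 `&` E J B.
  apply/seteqP; split => w /=.
    move=> h; split; first by have := h t (mem_head t J); rewrite /B' eqxx.
    move=> j /= jJ; have := h j; rewrite /= inE jJ orbT /B' => /(_ isT).
    by case: eqP => // jt; rewrite -jt jJ in tJ.
  by move=> [ht hJ] j /=; rewrite inE /B'; case: eqP => [->//|_ /= jJ]; exact: hJ.
have E1 : E [:: t] B' = s t @^-1` B1.
  rewrite /E (_ : [set` [:: t]] = [set t]) ?bigcap_set1 ?/B' ?eqxx//.
  by apply/seteqP; split => j /=; rewrite inE => /eqP.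
have H1 : P (st t @^-1` A2 `&` E (t :: J) B') = (P (st t @^-1` A2) * P (E (t :: J) B'))%E.
  apply: IH => //=; first by rewrite tJ.
  by move=> j; rewrite inE => /predU1P[->//|/geJ/ltnW].
have H2 : P (st t @^-1` A2 `&` E [:: t] B') = (P (st t @^-1` A2) * P (E [:: t] B'))%E.
  by apply: IH => // j; rewrite inE => /eqP ->.
have H3 : P (E (t :: J) B') = (P (s t @^-1` B1) * P (E J B))%E.
  rewrite /E !s_iid.1//=; last by rewrite tJ.
  rewrite big_cons /B' eqxx; congr (_ * _)%E; apply: eq_big_seq => j jJ.
  by case: eqP => // jt; rewrite -jt jJ in tJ.
rewrite -setIA -EB' H1 H3 muleA; congr (_ * _)%E.
by rewrite -E1 H2.
Qed.

Lemma pair_noise_indep t (A : set (borel (X * Uhat)%type)) (B : set (borel S)) :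
  measurable A -> measurable B ->
  (P (z t @^-1` A `&` s t @^-1` B) = P (z t @^-1` A) * P (s t @^-1` B))%E.
Proof.
move=> mA mB; pose A2 : set (borel X) := Y `&` (fun y => (y, pi t y)) @^-1` A.
have mA2 : measurable A2 by exact: measurable_graph_selection.
have -> : (fun w => z t w) @^-1` A = st t @^-1` A2.
  apply/seteqP; split => w /=; last by move=> [].
  by move=> ?; split => //; exact: state_viable.
have := @state_indep t [:: t] (fun=> B) isT _ (fun=> mB) A2 mA2.
rewrite (_ : [set` [:: t]] = [set t]) ?bigcap_set1; last first.
  by apply/seteqP; split => j /=; rewrite inE => /eqP.
by apply=> j; rewrite inE => /eqP ->.
Qed.

(** The noise at [t] is independent of the state-control pair at [t], so it can be integrated out
    with the pair frozen; identical distribution then replaces it by the generic noise in [EX]. *)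
Lemma state_markov t (phi : X -> R) M :
  measurable_fun (Y : set (borel X)) (phi : borel X -> R) ->
  (forall y, Y y -> `|phi y| <= M) ->
  \int[P]_w phi (st t.+1 w) = \int[P]_w EX phi (z t w).
Proof.
move=> mphi phiM.
pose h (p : borel (X * Uhat)%type * borel S) := phi (f p.1.1 p.1.2 p.2).
have mh : measurable_fun (G `*` setT : set (borel (X * Uhat)%type * borel S)%type) h.
  apply: (measurable_comp measurableY _ mphi measurable_dynamics).
  by move=> _ [p [/= [Yp Up] _] <-]; exact: f_viable.
have hM (p : borel (X * Uhat)%type * borel S) : G p.1 -> `|h p| <= M.
  by move=> Gp; exact: (bounded_next _ phiM Gp).
have := @Rintegral_indep _ Om R P _ (borel (X * Uhat)%type) _ (borel S) (z t) (s t)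
  (measurable_pair t) (@measurable_funPT _ _ _ _ (s t)) (@pair_noise_indep t) G h M measurable_graph mh hM
  (pair_viable t).
rewrite /h /= => ->; apply: eq_Rintegral => w _.
exact: (EX_noise t mphi phiM (pair_viable t w)).
Qed.

End plan.

(** * Testing [W] and [Omega] with lower semicontinuous functions *)

Lemma measurable_fst_graph (phi : X -> R) :
  measurable_fun (Y : set (borel X)) (phi : borel X -> R) ->
  measurable_fun (G : set (borel (X * Uhat)%type)) (fun z : borel (X * Uhat)%type => phi z.1).
Proof.
move=> mphi; apply: (measurable_comp measurableY _ mphi).
  by move=> _ [z [Yz _] <-].
move=> _; apply: (@measurability _ _ (borel (X * Uhat)%type) (borel X) _ _ (@open X)) => //.
move=> _ [B oB <-]; apply: measurableI => //; apply: sub_sigma_algebra.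
by apply: open_comp => // z _; exact: cvg_fst.
Qed.

Lemma measurable_EX (V : X -> R) M : lsc_on Y V -> (forall y, Y y -> `|V y| <= M) ->
  measurable_fun (G : set (borel (X * Uhat)%type)) (EX V : borel (X * Uhat)%type -> R).
Proof.
move=> lV VM.
have c0 : {within G, continuous (fun=> 0 : R)}.
  by apply: continuous_subspaceT => z; exact: cvg_cst.
have -> : EX V = (fun z => 0 + EX V z) by apply/funext => z; rewrite add0r.
exact: (lsc_on_measurable (lsc_on_cost_EX c0 lV VM)).
Qed.

Section graph_measure.
Context (mu : {finite_measure set (borel (X * Uhat)%type) -> \bar R}).

Lemma integrable_drift (V : X -> R) M : lsc_on Y V -> (forall y, Y y -> `|V y| <= M) ->
  mu.-integrable G (EFin \o (fun z => V z.1)) /\ mu.-integrable G (EFin \o EX V).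
Proof.
move=> lV VM; have mV := lsc_on_measurable lV; split.
  apply: (@bounded_integrable _ _ _ mu G _ M) => //; first exact: measurable_fst_graph.
  by move=> z [Yz _]; exact: VM.
apply: (@bounded_integrable _ _ _ mu G _ M) => //; first exact: (measurable_EX lV VM).
by move=> z Gz; exact: (EX_bound mV VM Gz).
Qed.

Lemma integral_drift (phi : X -> R) M : lsc_on Y phi -> (forall y, Y y -> `|phi y| <= M) ->
  (\int[mu]_(z in G) drift f s phi z = (\int[mu]_(z in G) (EX phi z - phi z.1))%:E)%E.
Proof.
move=> lphi phiM; have mphi := lsc_on_measurable lphi.
rewrite /Rintegral fineK; last first.
  apply: integrable_fin_num => //.
  have [i1 i2] := integrable_drift lphi phiM.
  exact: (integrableB measurable_graph i2 i1).
by apply: eq_integral => z /set_mem Gz; rewrite (driftE mphi phiM Gz).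
Qed.

End graph_measure.

Lemma lsc_test_W (gamma : probability (borel (X * Uhat)%type) R) (V : X -> R) M :
  W Y U f s gamma -> lsc_on Y V -> (forall y, Y y -> `|V y| <= M) ->
  \int[gamma]_(z in G) EX V z = \int[gamma]_(z in G) V z.1.
Proof.
move=> [_ Wg] lV VM.
have [G0|/set0P[z0 Gz0]] := eqVneq G set0; first by rewrite G0 !Rintegral_set0.
have Y0 : Y !=set0 by exists z0.1; case: Gz0.
have [phi [cphi phiM phiV phi_cvg]] := lsc_approx Y0 VM lV.
have cphiY j : {within Y, continuous (phi j)} by apply: continuous_subspaceT; exact: cphi.
have lphi j := continuous_lsc_on closedY (cphiY j).
have mphi j := lsc_on_measurable (lphi j).
have E j : \int[gamma]_(z in G) EX (phi j) z = \int[gamma]_(z in G) phi j z.1.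
  have := Wg _ (cphiY j); rewrite (integral_drift _ (lphi j) (phiM j)) => -[].
  have [i1 i2] := integrable_drift gamma (lphi j) (phiM j).
  by rewrite RintegralB// => /eqP; rewrite subr_eq0 => /eqP.
have C1 : \int[gamma]_(z in G) EX (phi j) z @[j --> \oo] --> \int[gamma]_(z in G) EX V z.
  apply: (bounded_cvg_Rintegral (M := M)) => //.
  - by move=> j; exact: (measurable_EX (lphi j) (phiM j)).
  - by move=> j z Gz; exact: (EX_bound (mphi j) (phiM j) Gz).
  - by move=> z Gz; exact: (EX_cvg mphi phiM phi_cvg Gz).
have C2 : \int[gamma]_(z in G) phi j z.1 @[j --> \oo] --> \int[gamma]_(z in G) V z.1.
  apply: (bounded_cvg_Rintegral (M := M)) => //.
  - by move=> j; exact: measurable_fst_graph.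
  - by move=> j z [Yz _]; exact: phiM.
  - by move=> z [Yz _]; exact: phi_cvg.
by move: C1; rewrite (funext E) => C1; exact: (cvg_unique _ C1 C2).
Qed.

Lemma lsc_test_Omega (p : probability (borel (X * Uhat)%type) R *
    {finite_measure set (borel (X * Uhat)%type) -> \bar R}) (y0 : X) (V : X -> R) M :
  Y y0 -> Omega Y U f s y0 p -> lsc_on Y V -> (forall y, Y y -> `|V y| <= M) ->
  V y0 - \int[p.1]_(z in G) V z.1 + \int[p.2]_(z in G) (EX V z - V z.1) = 0.
Proof.
move=> Yy0 [[gammaG _] _ Op] lV VM.
have Y0 : Y !=set0 by exists y0.
have [phi [cphi phiM phiV phi_cvg]] := lsc_approx Y0 VM lV.
have cphiY j : {within Y, continuous (phi j)} by apply: continuous_subspaceT; exact: cphi.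
have lphi j := continuous_lsc_on closedY (cphiY j).
have mphi j := lsc_on_measurable (lphi j).
(* The measure sits on [G], so the constant [phi j y0] integrates over [G] to itself. *)
have pG : p.1 G = 1%E.
  have := probability_setC p.1 measurable_graph; rewrite [X in X = _ -> _]gammaG.
  move=> /esym/eqP; rewrite sube_eq// ?fin_num_measure// ?fin_num_adde_defl//.
  by rewrite add0e => /eqP.
have E j : phi j y0 - \int[p.1]_(z in G) phi j z.1 +
    (\int[p.2]_(z in G) EX (phi j) z - \int[p.2]_(z in G) phi j z.1) = 0.
  have := Op _ (cphiY j); rewrite (integral_drift _ (lphi j) (phiM j)).
  have [i1 i2] := integrable_drift p.2 (lphi j) (phiM j).
  have [i3 _] := integrable_drift p.1 (lphi j) (phiM j).
  rewrite RintegralB//.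
  have i4 : (p.1).-integrable G (EFin \o (fun=> phi j y0)).
    by apply: (@bounded_integrable _ _ _ p.1 G _ M) => // z _; exact: phiM.
  have -> : (\int[p.1]_(z in G) (phi j y0 - phi j z.1)%:E)%E =
      (\int[p.1]_(z in G) (phi j y0 - phi j z.1))%:E.
    rewrite /Rintegral fineK//; apply: integrable_fin_num => //.
    exact: (integrableB measurable_graph i4 i3).
  rewrite RintegralB// Rintegral_cst// [X in fine X]pG mulr1 -EFinD.
  by case.
have C1 : \int[p.2]_(z in G) EX (phi j) z @[j --> \oo] --> \int[p.2]_(z in G) EX V z.
  apply: (bounded_cvg_Rintegral (M := M)) => //.
  - by move=> j; exact: (measurable_EX (lphi j) (phiM j)).
  - by move=> j z Gz; exact: (EX_bound (mphi j) (phiM j) Gz).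
  - by move=> z Gz; exact: (EX_cvg mphi phiM phi_cvg Gz).
have C2 (mu : {finite_measure set (borel (X * Uhat)%type) -> \bar R}) :
    \int[mu]_(z in G) phi j z.1 @[j --> \oo] --> \int[mu]_(z in G) V z.1.
  apply: (bounded_cvg_Rintegral (M := M)) => //.
  - by move=> j; exact: measurable_fst_graph.
  - by move=> j z [Yz _]; exact: phiM.
  - by move=> z [Yz _]; exact: phi_cvg.
have [i1 i2] := integrable_drift p.2 lV VM.
rewrite RintegralB//.
have C : phi j y0 - \int[p.1]_(z in G) phi j z.1 +
    (\int[p.2]_(z in G) EX (phi j) z - \int[p.2]_(z in G) phi j z.1) @[j --> \oo] -->
  V y0 - \int[p.1]_(z in G) V z.1 + (\int[p.2]_(z in G) EX V z - \int[p.2]_(z in G) V z.1).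
  by apply: cvgD; apply: cvgB => //; [exact: phi_cvg|exact: (C2 p.1)].
have C0 : (fun=> 0 : R) @ \oo --> (0 : R) by exact: cvg_cst.
by move: C; rewrite (funext E) => C; exact: (cvg_unique _ C C0).
Qed.

(** * Bellman iteration and bounds on the value *)

Section dynamic_programming.
Hypothesis (k_continuous : {within Y `*` [set: Uhat], continuous k}).
Context (K : R) (kK : forall z, G z -> `|k z| <= K).

Let K_ge0 : G !=set0 -> 0 <= K.
Proof. by move=> [z Gz]; exact: (le_trans (normr_ge0 (k z)) (kK Gz)). Qed.

Let kG : {within G, continuous k}.
Proof. exact: (continuous_subspaceW GYT k_continuous). Qed.

Let mk : measurable_fun (G : set (borel (X * Uhat)%type)) (k : borel (X * Uhat)%type -> R).
Proof. exact: (lsc_on_measurable (continuous_lsc_on closed_graph kG)). Qed.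

(** The last two clauses together are the Bellman equation: [V'] is a lower bound for the one-step
    cost over all admissible controls, and [sigma] attains it. *)
Definition bellman (V V' : X -> R) (sigma : X -> Uhat) : Prop :=
  [/\ measurable_fun (Y : set (borel X)) (sigma : borel X -> borel Uhat),
      forall y, Y y -> U y (sigma y),
      forall y, Y y -> V' y = k (y, sigma y) + EX V (y, sigma y) &
      forall z, G z -> V' z.1 <= k z + EX V z].

Lemma bellman_step (V : X -> R) M : lsc_on Y V -> (forall y, Y y -> `|V y| <= M) ->
  exists V' sigma, [/\ bellman V V' sigma, lsc_on Y V' &
    forall y, Y y -> `|V' y| <= K + M].
Proof.
move=> lV VM; have mV := lsc_on_measurable lV.
pose g z := k z + EX V z.
have gM z : G z -> `|g z| <= K + M.
  move=> Gz; apply: le_trans (ler_normD _ _) _.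
  by apply: lerD; [exact: kK|exact: (EX_bound mV VM Gz)].
have lg : lsc_on G g by exact: (lsc_on_cost_EX kG lV VM).
have GY z : G z -> Y z.1 by case.
have G0 y : Y y -> exists u, G (y, u).
  by move=> Yy; have [u Uu] := U_neq0 Yy; exists u.
have hX : hausdorff_space X by exact: norm_hausdorff.
have [sigma [ms sP]] := measurable_argmin hX Uhat_compact compact_graph GY G0 lg gM closedY.
exists (fun y => g (y, sigma y)), sigma; split.
- split => //.
  + by move=> y /sP[[]].
  + by move=> [y u] Gz /=; have [_] := sP y (GY _ Gz); apply.
(* Since the minimum is attained at [sigma y], the sublevel set of the new function is the
   projection of that of [g]. *)
- move=> c; have := closed_proj_sublevel hX compact_graph GY lg (c := c) closedT.
  congr closed; apply/seteqP; split => y /= [Yy].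
    by move=> [u [Gu _ gu]]; split => //; have [_ /(_ _ Gu) /le_trans] := sP y Yy; apply.
  by move=> gc; split => //; exists (sigma y); split => //; have [] := sP y Yy.
- by move=> y Yy; apply: gM; have [] := sP y Yy.
Qed.

Lemma bellman_sequence : exists (V : nat -> X -> R) (sigma : nat -> X -> Uhat),
  [/\ V 0%N = (fun=> 0), forall m, lsc_on Y (V m),
      forall m y, Y y -> `|V m y| <= K *+ m &
      forall m, bellman (V m) (V m.+1) (sigma m)].
Proof.
(* [choice] requires a total relation: the hypotheses become the premise of an implication, with an
   arbitrary value when they fail, and the counter [a.2] carries the bound along. *)
have step (a : (X -> R) * nat) : exists b : (X -> R) * (X -> Uhat),
    (lsc_on Y a.1 /\ forall y, Y y -> `|a.1 y| <= K *+ a.2) ->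
    [/\ bellman a.1 b.1 b.2, lsc_on Y b.1 & forall y, Y y -> `|b.1 y| <= K *+ a.2.+1].
  have [[l b]|] := pselect (lsc_on Y a.1 /\ forall y, Y y -> `|a.1 y| <= K *+ a.2).
    have [V' [sigma [? ? bV']]] := bellman_step l b.
    exists (V', sigma) => _; split => // y Yy.
    by rewrite mulrS; exact: bV'.
  by exists (a.1, fun=> point).
have [F FP] := choice step.
pose V := fix V m := if m is m'.+1 then (F (V m', m')).1 else (fun=> 0 : R).
have VP m : lsc_on Y (V m) /\ forall y, Y y -> `|V m y| <= K *+ m.
  elim: m => [|m IH] /=; last by have [_ ? ?] := FP (V m, m) IH.
  split; last by move=> y _; rewrite normr0 mulr0n.
  have c0 : {within Y, continuous (fun=> 0 : R)}.
    by apply: continuous_subspaceT; exact: cst_continuous.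
  exact: (continuous_lsc_on closedY c0).
exists V, (fun m => (F (V m, m)).2); split => //.
- by move=> m; have [] := VP m.
- by move=> m; have [] := VP m.
- by move=> m; have [] := FP (V m, m) (VP m).
Qed.

(** Averaging against a probability is monotone and preserves constants. *)
Lemma EX_shift (V V' : X -> R) M M' c z :
  lsc_on Y V -> lsc_on Y V' -> (forall y, Y y -> `|V y| <= M) ->
  (forall y, Y y -> `|V' y| <= M') -> (forall y, Y y -> V y - c <= V' y) ->
  G z -> EX V z - c <= EX V' z.
Proof.
move=> /lsc_on_measurable mV /lsc_on_measurable mV' VM VM' VV' Gz.
have i1 := prob_bounded_integrable P (measurable_next_noise 0 mV Gz)
  (fun w => bounded_next (s 0%N w) VM Gz).
have i2 := prob_bounded_integrable P (measurable_next_noise 0 mV' Gz)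
  (fun w => bounded_next (s 0%N w) VM' Gz).
have i3 : P.-integrable setT (EFin \o (fun=> c : R)).
  by apply: (@prob_bounded_integrable _ _ _ P _ (`|c|)).
rewrite -[c in X in X <= _](prob_Rintegral_cst P) -RintegralB//.
apply: le_Rintegral => //; first exact: (integrableB measurableT i1 i3).
by move=> w _; apply: VV'; case: Gz => ? ?; exact: f_viable.
Qed.

Section plan_cost.
Context (pi : nat -> X -> Uhat) (pi_plan : plan Y U pi) (y0 : X) (Yy0 : Y y0).
Local Notation st := (state f s pi y0).
Local Notation z t := (fun w => (st t w, control f s pi y0 t w)).

Lemma measurable_graph_pair (g : X * Uhat -> R) t :
  measurable_fun (G : set (borel (X * Uhat)%type)) (g : borel (X * Uhat)%type -> R) ->
  measurable_fun setT (fun w => g (z t w)).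
Proof.
move=> mg; apply: (measurable_comp measurable_graph _ mg (measurable_pair pi_plan Yy0 t)).
by move=> _ [w _ <-]; exact: pair_viable.
Qed.

Let mkz t : measurable_fun setT (fun w => k (z t w)).
Proof. exact: measurable_graph_pair. Qed.

Let kKz t w : `|k (z t w)| <= K.
Proof. by apply: kK; exact: pair_viable. Qed.

Lemma total_costE T :
  total_cost f s k pi y0 T = (\sum_(t < T) \int[P]_w k (z t w))%:E.
Proof.
have mS t : measurable_fun setT (fun w => \sum_(i < t) k (z i w)).
  by apply: measurable_sum => i; exact: mkz.
have bS t w : `|\sum_(i < t) k (z i w)| <= K *+ t.
  apply: le_trans (ler_norm_sum _ _ _) _.
  by rewrite -[t in _ *+ t]card_ord -sumr_const; apply: ler_sum => i _; exact: kKz.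
rewrite /total_cost unlock (prob_EFin_Rintegral P (mS T) (bS T)); congr EFin.
elim: T => [|T IH].
  by rewrite big_ord0; under eq_Rintegral do rewrite big_ord0; rewrite prob_Rintegral_cst.
rewrite big_ord_recr/= -IH -RintegralD//.
- by apply: eq_Rintegral => w _; rewrite big_ord_recr.
- exact: (prob_bounded_integrable P (mS T) (bS T)).
- exact: (prob_bounded_integrable P (mkz T) (@kKz T)).
Qed.

Lemma total_cost_ge T : ((- (K *+ T))%:E <= total_cost f s k pi y0 T)%E.
Proof.
rewrite total_costE lee_fin -mulNrn -[T in _ *+ T]card_ord -sumr_const.
apply: ler_sum => t _.
by have := prob_Rintegral_bound P (mkz t) (kKz t); rewrite ler_norml => /andP[].
Qed.

(** The Bellman equation is averaged along the trajectory, and the Markov property turns the mean of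
    [EX V] at time [t] into the mean of [V] at time [t.+1]. *)
Lemma bellman_cost (V V' : X -> R) M t : lsc_on Y V -> (forall y, Y y -> `|V y| <= M) ->
  bellman V V' (pi t) ->
  \int[P]_w V' (st t w) = \int[P]_w k (z t w) + \int[P]_w V (st t.+1 w).
Proof.
move=> lV VM [_ _ V'E _]; have mV := lsc_on_measurable lV.
rewrite (state_markov pi_plan Yy0 t mV VM) -RintegralD//.
- apply: eq_Rintegral => w _; exact/V'E/state_viable.
- exact: (prob_bounded_integrable P (mkz t) (@kKz t)).
- apply: (@prob_bounded_integrable _ _ _ P _ (M)).
    exact: (measurable_graph_pair t (measurable_EX lV VM)).
  by move=> w; apply: (EX_bound mV VM); exact: pair_viable.
Qed.

End plan_cost.

Section bellman_bounds.
Context (V : nat -> X -> R) (sigma : nat -> X -> Uhat).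
Hypotheses (V0 : V 0%N = (fun=> 0)) (lV : forall m, lsc_on Y (V m))
  (VM : forall m y, Y y -> `|V m y| <= K *+ m)
  (Vbellman : forall m, bellman (V m) (V m.+1) (sigma m)).

Lemma value_le_bellman y0 T : Y y0 -> (value Y U f s k y0 T <= (T%:R^-1 * V T y0)%:E)%E.
Proof.
move=> Yy0; rewrite /value EFinM; apply: lee_wpmul2l; first by rewrite lee_fin invr_ge0.
(* At time [t] there remain [T - t] steps, so the minimizer defining [V (T - t)] is used, that is
   [sigma] at index [T - t - 1]. From [T] on, truncated subtraction returns [sigma 0], which is
   still admissible. *)
pose pi t := sigma (T.-1 - t)%N.
have pi_plan : plan Y U pi by move=> t; have [] := Vbellman (T.-1 - t)%N.
apply: ge_ereal_inf; exists (total_cost f s k pi y0 T); first by exists pi.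
rewrite (total_costE pi_plan Yy0) lee_fin le_eqVlt; apply/orP; left; apply/eqP.
pose st := state f s pi y0; pose z t w := (st t w, control f s pi y0 t w).
(* Conserved along the plan: the mean cost already paid plus the mean optimal cost still to come. *)
have H t : (t <= T)%N -> V T y0 =
    \sum_(i < t) \int[P]_w k (z i w) + \int[P]_w V (T - t)%N (st t w).
  elim: t => [_|t IH tT]; first by rewrite big_ord0 add0r subn0 /st /= prob_Rintegral_cst.
  rewrite (IH (ltnW tT)) big_ord_recr/= -addrA; congr (_ + _).
  have E : (T - t = (T - t.+1).+1)%N by rewrite subnSK.
  have bell : bellman (V (T - t.+1)%N) (V (T - t.+1).+1%N) (pi t).
    by have := Vbellman (T - t.+1)%N; rewrite /pi -subn1 -subnDA add1n.
  rewrite E; exact: (bellman_cost pi_plan Yy0 (@lV (T - t.+1)%N) (@VM (T - t.+1)%N) bell).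
by rewrite (H T (leqnn T)) subnn V0 prob_Rintegral_cst addr0.
Qed.

Lemma value_ge y0 T : Y y0 -> ((- K)%:E <= value Y U f s k y0 T)%E.
Proof.
move=> Yy0; have [->|T0] := posnP T.
  (* The inverse of [0] is [0], so the value at [T = 0] is [0]. *)
  rewrite /value invr0 mul0e lee_fin oppr_le0; apply: K_ge0.
  by have [u Uu] := U_neq0 Yy0; exists (y0, u).
have -> : (- K)%:E = ((T%:R^-1)%:E * (- (K *+ T))%:E)%E.
  by rewrite -EFinM mulrN -[K *+ T]mulr_natl mulKf// pnatr_eq0 -lt0n.
apply: lee_wpmul2l; first by rewrite lee_fin invr_ge0.
by apply: le_ereal_inf_tmp => _ [pi pi_plan <-]; exact: total_cost_ge.
Qed.

(** It holds for [m = 0] because one step costs at least [- K]. It propagates by monotonicity: at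
    the minimizer for [V m.+2], replacing [V m.+1] by [V m] in the expectation loses at most [K],
    and what results bounds [V m.+1] from above. *)
Lemma bellman_decrease m y : Y y -> V m y - K <= V m.+1 y.
Proof.
elim: m y => [|m IH] y Yy.
  have [_ Us V1 _] := Vbellman 0%N.
  have Gz : G (y, sigma 0%N y) by split => //=; exact: Us.
  rewrite V1// V0 sub0r /EX prob_Rintegral_cst addr0.
  by have := kK Gz; rewrite ler_norml => /andP[].
have [_ Us V2 _] := Vbellman m.+1.
have Gz : G (y, sigma m.+1 y) by split => //=; exact: Us.
have h1 := EX_shift (@lV m) (@lV m.+1) (@VM m) (@VM m.+1) IH Gz.
have [_ _ _ /(_ _ Gz)/= h2] := Vbellman m.
rewrite (V2 y Yy).
lra.
Qed.

Lemma bellman_le_Omega y0 (p : probability (borel (X * Uhat)%type) R *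
    {finite_measure set (borel (X * Uhat)%type) -> \bar R}) T :
  Y y0 -> Omega Y U f s y0 p ->
  V T y0 <= (\int[p.1]_(z in G) k z) *+ T + (K + K) * fine (p.2 G).
Proof.
move=> Yy0 Op; have [Wp _ _] := Op.
have ik : (p.1).-integrable G (EFin \o k).
  exact: (@bounded_integrable _ _ _ p.1 G _ K).
(* Under [W] the [gamma]-integrals of [EX (V m)] and [V m] agree, so each Bellman inequality adds at
   most one integral of [k]. *)
have a_le m : \int[p.1]_(z in G) V m z.1 <= (\int[p.1]_(z in G) k z) *+ m.
  elim: m => [|m IH].
    by rewrite V0 mulr0n Rintegral_cst// mul0r.
  have [i1 i2] := integrable_drift p.1 (@lV m) (@VM (m)).
  have [i3 _] := integrable_drift p.1 (@lV m.+1) (@VM (m.+1)).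
  apply: (@le_trans _ _ (\int[p.1]_(z in G) k z + \int[p.1]_(z in G) V m z.1)); last first.
    by rewrite mulrS lerD2l.
  rewrite -(lsc_test_W Wp (@lV m) (@VM (m))) -RintegralD//.
  apply: le_Rintegral => //; first exact: (integrableD measurable_graph ik i2).
  by move=> z Gz; have [_ _ _] := Vbellman m; apply.
have := lsc_test_Omega Yy0 Op (@lV T) (@VM (T)).
(* One [K] is the loss in [bellman_decrease], the other bounds [k] in the inequality
   [V T.+1 <= k + EX (V T)]. *)
have : - ((K + K) * fine (p.2 G)) <= \int[p.2]_(z in G) (EX (V T) z - V T z.1).
  have [i1 i2] := integrable_drift p.2 (@lV T) (@VM (T)).
  rewrite -mulNr -Rintegral_cst//; apply: le_Rintegral => //.
  - by apply: (@bounded_integrable _ _ _ p.2 G _ `|- (K + K)|).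
  - exact: (integrableB measurable_graph i2 i1).
  - move=> z Gz; have [_ _ _ /(_ _ Gz)] := Vbellman T.
    have := bellman_decrease T Gz.1; have := kK Gz.
    by rewrite ler_norml => /andP[_ ?]; lra.
have := a_le T; lra.
Qed.

End bellman_bounds.

(** * Occupation measures of periodic regimes *)

Lemma kstar_le_periodic (pi : nat -> X -> Uhat) y0 : Y y0 -> plan Y U pi ->
  PRG Y f s pi y0 -> (kstar Y U f s k y0 <= limn (average_cost f s k pi y0))%E.
Proof.
move=> Yy0 pi_plan [T0 [p [p_gt0 per]]].
pose st := state f s pi y0; pose z t w := (st t w, control f s pi y0 t w).
have Gz t w : G (z t w) by exact: pair_viable.
have mz := measurable_pair pi_plan Yy0.
pose Z t : {mfun Om >-> borel (X * Uhat)%type} :=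
  MeasurableFun.Pack (MeasurableFun.Class (isMeasurableFun.Build _ _ _ _ _ (mz t))).
pose law t : {finite_measure set (borel (X * Uhat)%type) -> \bar R} := distribution P (Z t).
have law_int t (g : X * Uhat -> R) M :
    measurable_fun (G : set (borel (X * Uhat)%type)) (g : borel (X * Uhat)%type -> R) ->
    (forall z, G z -> `|g z| <= M) ->
    \int[law t]_(z in G) g z = \int[P]_w g (z t w).
  move=> mg gM.
  exact: (Rintegral_distribution_on P measurable_graph (X := Z t) (Gz t) mg gM).
have law_off t : law t (~` G) = 0%E by exact: (distribution_off P (X := Z t) (Gz t)).
(* gamma averages the laws of the state-control pair over one period. xi averages
   the sums of the laws before each time of that period, so the drift of a test
   function integrated against xi telescopes. *)
have cp0 : 0 <= p%:R^-1 :> R by rewrite invr_ge0.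
pose cp := NngNum cp0.
have [gamma gammaE] : exists Q : probability (borel (X * Uhat)%type) R,
    forall A, Q A = weighted_sum (fun i => law (T0 + i)%N) p cp A.
  apply: weighted_sum_probability; rewrite weighted_sumE.
  rewrite (eq_bigr (fun=> 1%:E)); last by move=> i _; exact: probability_setT.
  rewrite sumEFin sumr_const card_ord -EFinM /= mulVf//.
  by rewrite pnatr_eq0 -lt0n.
pose xi : {finite_measure set (borel (X * Uhat)%type) -> \bar R} :=
  weighted_sum (fun i => weighted_sum law (T0 + i)%N (NngNum ler01)) p cp.
have gamma_int (g : X * Uhat -> R) M :
    measurable_fun (G : set (borel (X * Uhat)%type)) (g : borel (X * Uhat)%type -> R) ->
    (forall z, G z -> `|g z| <= M) ->
    \int[gamma]_(z in G) g z = p%:R^-1 * \sum_(i < p) \int[P]_w g (z (T0 + i)%N w).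
  move=> mg gM; transitivity (\int[weighted_sum (fun i => law (T0 + i)%N) p cp]_(z in G) g z).
    by rewrite /Rintegral; congr fine; apply: eq_measure_integral => A _ _; exact: gammaE.
  rewrite (Rintegral_weighted_sum _ _ _ measurable_graph mg gM); congr (_ * _).
  by apply: eq_bigr => i _; exact: law_int gM.
have xi_int (g : X * Uhat -> R) M :
    measurable_fun (G : set (borel (X * Uhat)%type)) (g : borel (X * Uhat)%type -> R) ->
    (forall z, G z -> `|g z| <= M) ->
    \int[xi]_(z in G) g z =
    p%:R^-1 * \sum_(i < p) \sum_(t < T0 + i) \int[P]_w g (z t w).
  move=> mg gM; rewrite (Rintegral_weighted_sum _ _ _ measurable_graph mg gM); congr (_ * _).
  apply: eq_bigr => i _; rewrite (Rintegral_weighted_sum _ _ _ measurable_graph mg gM) mul1r.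
  by apply: eq_bigr => t _; exact: law_int gM.
pose e (phi : X -> R) t := \int[P]_w phi (st t w).
have drift_step (phi : X -> R) M t : lsc_on Y phi -> (forall y, Y y -> `|phi y| <= M) ->
    \int[P]_w (EX phi (z t w) - phi (st t w)) = e phi t.+1 - e phi t.
  move=> lphi phiM; have mphi := lsc_on_measurable lphi.
  rewrite /e (state_markov pi_plan Yy0 t mphi phiM) RintegralB//.
    apply: (@prob_bounded_integrable _ _ _ P _ M).
      exact: (measurable_graph_pair pi_plan Yy0 t (measurable_EX lphi phiM)).
    by move=> w; exact: (EX_bound mphi phiM).
  apply: (@prob_bounded_integrable _ _ _ P _ M).
    exact: (measurable_graph_pair pi_plan Yy0 t (measurable_fst_graph mphi)).
  by move=> w; apply: phiM; case: (Gz t w).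
have drift_meas (phi : X -> R) M : lsc_on Y phi -> (forall y, Y y -> `|phi y| <= M) ->
    measurable_fun (G : set (borel (X * Uhat)%type))
      ((fun z => EX phi z - phi z.1) : borel (X * Uhat)%type -> R) /\
    forall z, G z -> `|EX phi z - phi z.1| <= M + M.
  move=> lphi phiM; have mphi := lsc_on_measurable lphi; split.
    by apply: measurable_funB; [exact: (measurable_EX lphi phiM)|exact: measurable_fst_graph].
  move=> v Gv; apply: le_trans (ler_normB _ _) _; apply: lerD.
    exact: (EX_bound mphi phiM Gv).
  by apply: phiM; case: Gv.
have perR (q : X * Uhat -> R) M : {within Y `*` [set: Uhat], continuous q} ->
    (forall z, G z -> `|q z| <= M) -> forall t, (T0 <= t)%N ->
    \int[P]_w q (z (t + p)%N w) = \int[P]_w q (z t w).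
  move=> cq qM t T0t; have := per q cq t T0t; rewrite unlock.
  have mq := lsc_on_measurable (continuous_lsc_on closed_graph (continuous_subspaceW GYT cq)).
  have H i := prob_EFin_Rintegral P
    (measurable_graph_pair pi_plan Yy0 i mq) (fun w => qM _ (Gz i w)).
  by rewrite !H => -[].
have Wgamma : W Y U f s gamma.
  split; first by rewrite gammaE weighted_sumE big1 ?mule0// => i _; exact: law_off.
  move=> phi cphi; have lphi := continuous_lsc_on closedY cphi.
  have [M _ phiM] := compact_continuous_bounded Y_compact cphi.
  have [mg gM] := drift_meas _ _ lphi phiM.
  rewrite (integral_drift gamma lphi phiM) (gamma_int _ _ mg gM); congr EFin.
  rewrite (eq_bigr (fun i : 'I_p => e phi (T0 + i).+1 - e phi (T0 + i)%N)); last first.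
    by move=> i _; exact: (drift_step _ M).
  (* Over a full period only the endpoints [T0] and [T0 + p] remain, and periodicity applied to
     [phi] as a function of the pair equates them. *)
  rewrite telescope_shift [X in X - _](_ : _ = e phi T0) ?subrr ?mulr0//.
  have cq : {within Y `*` [set: Uhat], continuous (fun z : X * Uhat => phi z.1)}.
    exact: within_continuous_fst.
  by apply: (perR _ M cq) => // v [Yv _]; exact: phiM.
have Op : Omega Y U f s y0 (gamma, xi).
  split => //=.
    transitivity (cp%:num%:E * \sum_(i < p)
      weighted_sum law (T0 + i)%N (NngNum ler01) (~` G))%E; first by [].
    rewrite big1 ?mule0// => i _; rewrite weighted_sumE big1 ?mule0// => t _; exact: law_off.
  move=> phi cphi; have lphi := continuous_lsc_on closedY cphi.
  have mphi := lsc_on_measurable lphi.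
  have [M _ phiM] := compact_continuous_bounded Y_compact cphi.
  have [mg gM] := drift_meas _ _ lphi phiM.
  rewrite (integral_drift xi lphi phiM) (xi_int _ _ mg gM).
  have mh : measurable_fun (G : set (borel (X * Uhat)%type))
      ((fun z => phi y0 - phi z.1) : borel (X * Uhat)%type -> R).
    by apply: measurable_funB => //; exact: measurable_fst_graph.
  have hM v : G v -> `|phi y0 - phi v.1| <= M + M.
    move=> [Yv _]; apply: le_trans (ler_normB _ _) _.
    by apply: lerD; exact: phiM.
  rewrite (EFin_Rintegral gamma measurable_graph mh hM) (gamma_int _ _ mh hM).
  (* The averages cancel term by term: for each [i], telescoping from time [0] to [T0 + i] gives the
     mean of [phi] at time [T0 + i] minus [phi y0], the opposite of the contribution of [gamma]. *)
  rewrite -EFinD -mulrDr -big_split /= big1 ?mulr0// => i _.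
  rewrite (eq_bigr (fun t : 'I_(T0 + i) => e phi (0 + t).+1 - e phi (0 + t)%N)); last first.
    by move=> t _; exact: (drift_step _ M).
  rewrite telescope_shift add0n.
  have -> : e phi 0%N = phi y0 by rewrite /e /= prob_Rintegral_cst.
  rewrite RintegralB//; last 2 first.
  - by apply: (@prob_bounded_integrable _ _ _ P _ M) => // w; exact: phiM.
  - apply: (@prob_bounded_integrable _ _ _ P _ M).
      exact: (measurable_graph_pair pi_plan Yy0 _ (measurable_fst_graph mphi)).
    by move=> w; apply: phiM; case: (Gz (T0 + i)%N w).
  by rewrite prob_Rintegral_cst /e /=; lra.
pose c t := \int[P]_w k (z t w).
have c_per t : (T0 <= t)%N -> c (t + p)%N = c t.
  exact: (perR k K k_continuous kK).
(* The costs [c t] are eventually periodic, so this limit exists and is the mean over one period,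
   which is how [gamma] was built. *)
have -> : limn (average_cost f s k pi y0) = (\int[gamma]_(z in G) (k z)%:E)%E.
  apply/cvg_lim => //; rewrite (EFin_Rintegral gamma measurable_graph mk kK).
  rewrite (gamma_int _ _ mk kK).
  have -> : average_cost f s k pi y0 = EFin \o (fun T => T%:R^-1 * \sum_(t < T) c t).
    by apply/funext => T; rewrite /average_cost (total_costE pi_plan Yy0).
  by apply: cvg_EFin; [exact: nearW|exact: (cvg_periodic_mean p_gt0 c_per)].
by apply: ereal_inf_lbound; exists (gamma, xi).
Qed.

Lemma kstar_le_value_per y0 : Y y0 ->
  (kstar Y U f s k y0 <= value_per Y U f s k y0)%E.
Proof.
move=> Yy0; apply: le_ereal_inf_tmp => _ [pi [pi_plan per] <-].
exact: kstar_le_periodic.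
Qed.

(** * Convergence of the averaged values *)

Lemma value_cvg_kstar y0 : Y y0 ->
  value_per Y U f s k y0 = limn_einf (value Y U f s k y0) ->
  exists v : R, value Y U f s k y0 T @[T --> \oo] --> v%:E /\ v%:E = kstar Y U f s k y0.
Proof.
move=> Yy0 per_liminf; have per_kstar := kstar_le_value_per Yy0.
have [V' [sigma' [V'0 lV' V'M V'bell]]] := bellman_sequence.
set u := value Y U f s k y0 in per_liminf *.
have K0 : 0 <= K by apply: K_ge0; have [v Uv] := U_neq0 Yy0; exists (y0, v).
have u_ge T : ((- K)%:E <= u T)%E by exact: value_ge.
have u_le T : (u T <= (T%:R^-1 * V' T y0)%:E)%E.
  exact: (value_le_bellman V'0 lV' V'M V'bell T Yy0).
have u_leK T : (u T <= K%:E)%E.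
  apply: le_trans (u_le T) _; rewrite lee_fin.
  have [->|T0] := posnP T; first by rewrite invr0 mul0r.
  rewrite ler_pdivrMl ?ltr0n// mulr_natl; apply: le_trans (ler_norm _) _.
  exact: V'M.
have u_fin T : u T \is a fin_num.
  rewrite fin_numE -ltNye -ltey (lt_le_trans _ (u_ge T)) ?ltNyr//.
  by rewrite (le_lt_trans (u_leK T)) ?ltry.
pose r T := fine (u T).
have uE T : u T = (r T)%:E by rewrite /r fineK.
have cvg_einfs : einfs u @ \oo --> limn_einf u.
  rewrite limn_einf_lim; exact: is_cvg_einfs.
have L_fin : limn_einf u \is a fin_num.
  have geL : ((- K)%:E <= limn_einf u)%E.
    rewrite limn_einf_lim; apply: lime_ge; first exact: is_cvg_einfs.
    by apply: nearW => T; apply: le_ereal_inf_tmp => _ [m _ <-]; exact: u_ge.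
  have leL : (limn_einf u <= K%:E)%E.
    rewrite limn_einf_lim; apply: lime_le; first exact: is_cvg_einfs.
    by apply: nearW => T; apply: ge_ereal_inf; exists (u T) => //; exists T => /=.
  by rewrite fin_numE -ltNye -ltey (lt_le_trans _ geL) ?ltNyr// (le_lt_trans leL) ?ltry.
pose L := fine (limn_einf u).
have LE : limn_einf u = L%:E by rewrite /L fineK.
rewrite per_liminf LE in per_kstar.
have up (p : probability (borel (X * Uhat)%type) R *
    {finite_measure set (borel (X * Uhat)%type) -> \bar R}) e : Omega Y U f s y0 p -> 0 < e ->
    \forall T \near \oo, r T <= \int[p.1]_(z in G) k z + e.
  move=> Op e0; set C := (K + K) * fine (p.2 G).
  near=> T; have T0 : (0 < T)%N by near: T; exact: nbhs_infty_gt.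
  have TR : 0 < T%:R :> R by rewrite ltr0n.
  rewrite -lee_fin -uE; apply: le_trans (u_le T) _; rewrite lee_fin ler_pdivrMl//.
  have := bellman_le_Omega V'0 lV' V'M V'bell T Yy0 Op; rewrite -/C => h.
  apply: (le_trans h); rewrite mulrDr mulr_natl lerD2l -ler_pdivrMr//.
  near: T; exact: nbhs_infty_ger.
have EK (p : probability (borel (X * Uhat)%type) R *
    {finite_measure set (borel (X * Uhat)%type) -> \bar R}) :
    (\int[p.1]_(z in G) (k z)%:E)%E = (\int[p.1]_(z in G) k z)%:E.
  exact: (EFin_Rintegral p.1 measurable_graph mk kK).
have rL : r @ \oo --> L.
  apply/cvgrPdist_le => e e0.
  have e2 : 0 < e / 2 by rewrite divr_gt0.
  (* The infimum [kstar] is at most the finite [L], so [Omega] has a member whose cost is below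
     [L + e / 2]; the other half of [e] is left for [up]. *)
  have [_ [p Op <-]] : exists2 x,
      [set (\int[p.1]_(z in G) (k z)%:E)%E | p in Omega Y U f s y0] x
      & (x < (L + e / 2)%:E)%E.
    by apply: ereal_inf_lt; apply: le_lt_trans per_kstar _; rewrite lte_fin ltrDl.
  rewrite EK lte_fin => pL; have := up p _ Op e2.
  (* The tail infima converge to [L] and lie below the values, which gives the lower estimate. *)
  have : \forall T \near \oo, ((L - e)%:E < einfs u T)%E.
    have nL : nbhs L%:E [set x | ((L - e)%:E < x)%E].
      apply: open_nbhs_nbhs; split; first exact: open_ereal_gt_ereal.
      by rewrite /= lte_fin ltrBlDr ltrDl.
    by move: cvg_einfs; rewrite LE => /(_ _ nL).
  apply: filterS2 => T h1 h2; rewrite ler_norml; apply/andP; split; first by lra.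
  have : (einfs u T <= u T)%E by apply: ge_ereal_inf; exists (u T) => //; exists T => /=.
  by move=> /(lt_le_trans h1); rewrite uE lte_fin => ?; lra.
exists L; split.
  by apply: cvg_EFin; [exact: nearW|exact: rL].
(* For the remaining inequality, [up] passes to the limit for each member of [Omega], so [L] is
   below every competing cost. *)
apply/eqP; rewrite eq_le per_kstar andbT.
apply: le_ereal_inf_tmp => _ [p Op <-]; rewrite EK lee_fin.
apply/ler_addgt0Pr => e e0.
exact: (closed_cvg _ (closed_le (y := _)) (up p e Op e0) _ rL).
Unshelve. all: by end_near. Qed.

End dynamic_programming.

End control_system_theory.

Theorem proposition5p5 (R : realType)
    (d : measure_display) (Om : measurableType d) (P : probability Om R)
    (n : nat) (Uhat : pmetricType R) (S : completeMetricType R)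
    (Y : set 'rV[R]_n) (U : 'rV[R]_n -> set Uhat)
    (f : 'rV[R]_n -> Uhat -> S -> 'rV[R]_n)
    (s : nat -> {RV P >-> borel S}) (k : 'rV[R]_n * Uhat -> R)
    (Y_neq0 : Y !=set0) (Y_compact : compact Y)
    (Uhat_compact : compact [set: Uhat])
    (S_separable : separable S)
    (f_bounded : exists M : R, forall y u x, Y y -> `|f y u x| <= M)
    (f_continuous : forall x : S,
      {within Y `*` [set: Uhat], continuous (fun z => f z.1 z.2 x)})
    (f_measurable : forall y u, Y y ->
      measurable_fun [set: borel S] (f y u : borel S -> borel 'rV[R]_n))
    (s_iid : iid s)
    (U_neq0 : forall y, Y y -> U y !=set0)
    (U_compact : forall y, Y y -> compact (U y))
    (U_usc : upper_semicontinuous_on Y U)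
    (f_viable : forall y u x, Y y -> U y u -> Y (f y u x))
    (k_continuous : {within Y `*` [set: Uhat], continuous k})
    (y0 : 'rV[R]_n) (Yy0 : Y y0) :
  value_per Y U f s k y0 = limn_einf (value Y U f s k y0) ->
  exists v : R, value Y U f s k y0 T @[T --> \oo] --> v%:E /\
    v%:E = kstar Y U f s k y0.
Proof.
have [K _ kK] := compact_continuous_bounded (compact_setX Y_compact Uhat_compact) k_continuous.
have kG z : graph Y U z -> `|k z| <= K by move=> [Yz _]; exact: kK.
exact: (value_cvg_kstar Y_compact Uhat_compact f_continuous f_measurable s_iid U_neq0
  U_compact U_usc f_viable k_continuous kG Yy0).
Qed.
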